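(* Let $(\mathcal{F},\tau)$ be a bornological locally convex Hausdorff space of $\mathbb{K}$-valued functions on a non-empty set $\Omega$, and let $\mathcal{B}$ be the family of $\tau$-bounded subsets of $\mathcal{F}$. Then the following assertions are equivalent. (a) $(\mathcal{F},\tau)$ admits a strong complete barrelled linearisation. (b) $(\mathcal{F},\tau)$ has a prebidual $(Y,\varphi)$ with $Y$ a semi-Montel space such that $Y_b'$ is complete and for every $x\in\Omega$ there is a unique $y_x'\in Y'$ with $\delta_x=\varphi(\cdot)(y_x')$. (c) There is a locally convex Hausdorff topology $\widetilde{\tau}$ on $\mathcal{F}$ with $\tau_{\mathrm{p}}\leq\widetilde{\tau}$ such that $(\mathcal{F},\tau)$ satisfies (BBC) and (CNC) for $\widetilde{\tau}$ and $(\mathcal{F},\widetilde{\gamma})$ satisfies $(\mathrm{B}\tau\mathrm{B}\widetilde{\gamma})$, where $\widetilde{\gamma}=\widetilde{\gamma}(\tau,\widetilde{\tau})$. (d) There is a locally convex Hausdorff topology $\widetilde{\tau}$ on $\mathcal{F}$ with $\tau_{\mathrm{p}}\leq\widetilde{\tau}$ such that $(\mathcal{F},\tau)$ satisfies (BBCl) and (CNC) for $\widetilde{\tau}$ and $(\mathcal{F},\widetilde{\gamma})$, $\widetilde{\gamma}=\widetilde{\gamma}(\tau,\widetilde{\tau})$, is semi-reflexive and satisfies $(\mathrm{B}\tau\mathrm{B}\widetilde{\gamma})$. (e) There is a locally convex Hausdorff topology $\widetilde{\tau}$ on $\mathcal{F}$ with $\tau_{\mathrm{p}}\leq\widetilde{\tau}$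 such that $(\mathcal{F},\tau)$ satisfies (BBC) and (CNC) for $\widetilde{\tau}$. (f) There is a locally convex Hausdorff topology $\widetilde{\tau}$ on $\mathcal{F}$ such that $(\mathcal{F},\tau)$ satisfies (BBC) and (CNC) for $\widetilde{\tau}$ and $\delta_x\in\mathcal{F}_{\mathcal{B},\widetilde{\tau}}'$ for all $x\in\Omega$.
   Context: $\mathbb{K}\in\{\mathbb{R},\mathbb{C}\}$. For a locally convex Hausdorff (lcH) space $Y$, $Y'$ is its topological dual and $Y_b'=(Y',\beta(Y',Y))$ its strong dual. A prebidual of an lcH space $X$ is a pair $(Y,\varphi)$ of an lcH space $Y$ and a topological isomorphism $\varphi\colon X\to (Y_b')_b'$. For $x\in\Omega$, $\delta_x(f)=f(x)$ is the point evaluation; $\tau_{\mathrm{p}}$ is the topology of pointwise convergence on $\mathcal{F}$. A linearisation of $\mathcal{F}$ is a triple $(\delta,Y,T)$ of an lcH space $Y$ over $\mathbb{K}$, a map $\delta\colon\Omega\to Y$ and an algebraic isomorphism $T\colon\mathcal{F}\to Y'$ with $T(f)\circ\delta=f$ for all $f\in\mathcal{F}$. It is strong if $T\colon(\mathcal{F},\tau)\to Y_b'$ is a topological isomorphism; it is complete barrelled if $Y$ is complete and barrelled. For an lcH space $(X,\tau)$ and an lcH topology $\widetilde{\tau}$ on $X$: $(X,\tau)$ satisfies (BBC) for $\widetilde{\tau}$ if every $\tau$-bounded set is contained in an absolutely convex $\tau$-bounded $\widetilde{\tau}$-compact set; (BBCl) for $\widetilde{\tau}$ if every $\tau$-bounded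 set is contained in an absolutely convex $\tau$-bounded $\widetilde{\tau}$-closed set; (CNC) for $\widetilde{\tau}$ if $\tau$ has a $0$-neighbourhood basis of absolutely convex $\widetilde{\tau}$-closed sets. $\widetilde{\gamma}(\tau,\widetilde{\tau})$ denotes the finest lcH topology on $X$ coinciding with $\widetilde{\tau}$ on all $\tau$-bounded sets; $(X,\widetilde{\gamma})$ satisfies $(\mathrm{B}\tau\mathrm{B}\widetilde{\gamma})$ if a subset of $X$ is $\tau$-bounded iff it is $\widetilde{\gamma}$-bounded. With $\mathcal{B}$ the $\tau$-bounded sets, $X_{\mathcal{B},\widetilde{\tau}}'$ is the space of linear functionals $X\to\mathbb{K}$ whose restriction to every $B\in\mathcal{B}$ is $\widetilde{\tau}$-continuous. *)

(* Defs.v *)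
From HB Require Import structures.
From mathcomp Require Import all_boot all_algebra.
From Stdlib Require List.
From mathcomp Require Import complex.
From mathcomp Require Import all_classical all_reals.
Set Implicit Arguments.
Unset Strict Implicit.
Unset Printing Implicit Defensive.
Import GRing.Theory Num.Theory.
Local Open Scope ring_scope.
Local Open Scope classical_set_scope.

Definition KK (R : realType) (b : bool) : numFieldType :=
  if b then (R[i] : numFieldType) else (R : numFieldType).

(* Locally convex spaces.  A locally convex space is represented by a        *)
(* linear subspace S of an ambient K-module V together with a base N of      *)
(* 0-neighbourhoods (absolutely convex, absorbing subsets of S) of a         *)
(* translation invariant locally convex topology on S.  Every locally        *)
(* convex topology arises like this, and the topology is determined by N.    *)
Section LCS.
Variable K : numFieldType.

Section Basic.
Variable V : lmodType K.

Definition subspace (S : set V) :=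
  S 0 /\ (forall (a : K) x y, S x -> S y -> S (a *: x + y)).

Definition absconvex (A : set V) :=
  forall (a c : K) x y, A x -> A y -> `|a| + `|c| <= 1 -> A (a *: x + c *: y).

Definition scale_set (t : K) (A : set V) : set V := [set t *: x | x in A].

Definition absorbs (A B : set V) :=
  exists t : K, 0 < t /\ forall s : K, t <= `|s| -> B `<=` scale_set s A.

Definition absorbing (S A : set V) := forall x, S x -> absorbs A [set x].

Definition lcH (S : set V) (N : set (set V)) :=
  [/\ subspace S /\ (exists U, N U),
      (forall U, N U -> [/\ U `<=` S, absconvex U & absorbing S U]),
      (forall U1 U2, N U1 -> N U2 -> exists U3, N U3 /\ U3 `<=` U1 `&` U2),
      (forall U, N U -> exists W, N W /\ scale_set 2 W `<=` U) &
      (forall x, S x -> x != 0 -> exists U, N U /\ ~ U x)].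

Definition nbhd0 (N : set (set V)) (A : set V) := exists U, N U /\ U `<=` A.

Definition coarser (N1 N2 : set (set V)) :=
  forall U, N1 U -> exists W, N2 W /\ W `<=` U.

Definition translate (a : V) (U : set V) : set V := [set a + u | u in U].

Definition is_open (S : set V) (N : set (set V)) (A : set V) :=
  A `<=` S /\ forall a, A a -> exists U, N U /\ translate a U `<=` A.

Definition is_closed (S : set V) (N : set (set V)) (A : set V) :=
  A `<=` S /\ forall a, S a -> ~ A a ->
    exists U, N U /\ translate a U `&` A = set0.

Definition closure (S : set V) (N : set (set V)) (A : set V) : set V :=
  [set a | S a /\ forall U, N U -> exists u, U u /\ A (a + u)].

Definition is_compact (S : set V) (N : set (set V)) (C : set V) :=
  C `<=` S /\
  forall O : set (set V), (forall A, O A -> is_open S N A) ->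
    C `<=` [set x | exists A, O A /\ A x] ->
    exists s : seq (set V), (forall A, List.In A s -> O A) /\
      C `<=` [set x | exists A, List.In A s /\ A x].

Definition bounded (S : set V) (N : set (set V)) (B : set V) :=
  B `<=` S /\ forall U, N U -> absorbs U B.

Definition filter_on (S : set V) (F : set (set V)) :=
  [/\ F S, ~ F set0, (forall A, F A -> A `<=` S),
      (forall A B, F A -> F B -> F (A `&` B)) &
      (forall A B, F A -> A `<=` B -> B `<=` S -> F B)].

Definition cauchy (N : set (set V)) (F : set (set V)) :=
  forall U, N U -> exists A, F A /\ forall x y, A x -> A y -> U (x - y).

Definition converges (N : set (set V)) (F : set (set V)) (a : V) :=
  forall U, N U -> F (translate a U).

Definition complete (S : set V) (N : set (set V)) :=
  forall F, filter_on S F -> cauchy N F -> exists a, S a /\ converges N F a.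

Definition barrelled (S : set V) (N : set (set V)) :=
  forall A, A `<=` S -> absconvex A -> absorbing S A -> is_closed S N A ->
    nbhd0 N A.

Definition bornological (S : set V) (N : set (set V)) :=
  forall A, A `<=` S -> absconvex A ->
    (forall B, bounded S N B -> absorbs A B) -> nbhd0 N A.

Definition semi_montel (S : set V) (N : set (set V)) :=
  forall B, bounded S N B -> is_compact S N (closure S N B).

(* topological dual: continuous linear functionals on S, normalised to *)
(* vanish outside S (so that each functional has a unique representative) *)
Definition dual (S : set V) (N : set (set V)) : set (V -> K^o) :=
  [set f : V -> K^o | [/\ (forall (a : K) x y, S x -> S y -> f (a *: x + y) = a *: f x + f y),
               (forall v, ~ S v -> f v = 0) &
               (exists U, N U /\ forall v, U v -> `|(f v : K)| <= 1)]].

Definition polar (S : set V) (N : set (set V)) (B : set V) : set (V -> K^o) :=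
  [set f : V -> K^o | dual S N f /\ forall y, B y -> `|(f y : K)| <= 1].

Definition strong_base (S : set V) (N : set (set V)) : set (set (V -> K^o)) :=
  [set P | exists B, bounded S N B /\ P = polar S N B].

Definition coincide_on (B : set V) (N1 N2 : set (set V)) :=
  forall a, B a ->
    (forall U, N1 U -> exists W, N2 W /\
       [set x | B x /\ W (x - a)] `<=` [set x | B x /\ U (x - a)]) /\
    (forall U, N2 U -> exists W, N1 W /\
       [set x | B x /\ W (x - a)] `<=` [set x | B x /\ U (x - a)]).

Definition is_gamma (S : set V) (Ntau Nt Ng : set (set V)) :=
  [/\ lcH S Ng,
      (forall B, bounded S Ntau B -> coincide_on B Nt Ng) &
      (forall Ns, lcH S Ns -> (forall B, bounded S Ntau B -> coincide_on B Nt Ns) ->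
         coarser Ns Ng)].

Definition BBC (S : set V) (Ntau Nt : set (set V)) :=
  forall B, bounded S Ntau B -> exists C,
    [/\ B `<=` C, absconvex C, bounded S Ntau C & is_compact S Nt C].

Definition BBCl (S : set V) (Ntau Nt : set (set V)) :=
  forall B, bounded S Ntau B -> exists C,
    [/\ B `<=` C, absconvex C, bounded S Ntau C & is_closed S Nt C].

Definition CNC (S : set V) (Ntau Nt : set (set V)) :=
  forall U, nbhd0 Ntau U -> exists W,
    [/\ W `<=` U, nbhd0 Ntau W, absconvex W & is_closed S Nt W].

Definition BtBg (S : set V) (Ntau Ng : set (set V)) :=
  forall B, B `<=` S -> (bounded S Ntau B <-> bounded S Ng B).

Definition Bdual (S : set V) (Ntau Nt : set (set V)) (l : V -> K^o) :=
  (forall (a : K) x y, S x -> S y -> l (a *: x + y) = a *: l x + l y) /\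
  forall B, bounded S Ntau B -> forall a, B a -> forall e : K, 0 < e ->
    exists W, Nt W /\ forall x, B x -> W (x - a) -> `|(l x - l a : K)| <= e.

End Basic.

Definition semi_reflexive (V : lmodType K) (S : set V) (N : set (set V)) :=
  forall Phi, dual (dual S N) (strong_base S N) Phi ->
    exists x, S x /\ forall f, dual S N f -> Phi f = f x.

Section Maps.
Variables (V W : lmodType K).

Definition linear_on (S : set V) (f : V -> W) :=
  forall (a : K) x y, S x -> S y -> f (a *: x + y) = a *: f x + f y.

Definition alg_iso (S1 : set V) (S2 : set W) (f : V -> W) :=
  [/\ linear_on S1 f,
      (forall x, S1 x -> S2 (f x)),
      (forall y, S2 y -> exists x, S1 x /\ f x = y) &
      (forall x y, S1 x -> S1 y -> f x = f y -> x = y)].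

Definition top_iso (S1 : set V) (N1 : set (set V)) (S2 : set W) (N2 : set (set W))
    (f : V -> W) :=
  [/\ alg_iso S1 S2 f,
      (forall U2, N2 U2 -> exists U1, N1 U1 /\ f @` U1 `<=` U2) &
      (forall U1, N1 U1 -> exists U2, N2 U2 /\ U2 `<=` f @` U1)].
End Maps.

Section Functions.
Variable Omega : Type.

Definition pointwise_base (F : set (Omega -> K^o)) : set (set (Omega -> K^o)) :=
  [set U | exists (s : seq Omega) (e : K), 0 < e /\
     U = [set f : Omega -> K^o | F f /\ forall x, List.In x s -> `|(f x : K)| <= e]].

Definition linearisation (F : set (Omega -> K^o)) (V : lmodType K) (S : set V)
    (N : set (set V)) (delta : Omega -> V) (T : (Omega -> K^o) -> (V -> K^o)) :=
  [/\ (forall x, S (delta x)),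
      alg_iso F (dual S N) T &
      (forall f, F f -> forall x, T f (delta x) = f x)].

Definition strong_linearisation (F : set (Omega -> K^o)) (Ntau : set (set (Omega -> K^o)))
    (V : lmodType K) (S : set V) (N : set (set V)) delta T :=
  linearisation F S N delta T /\
  top_iso F Ntau (dual S N) (strong_base S N) T.

Definition admits_scb_linearisation (F : set (Omega -> K^o))
    (Ntau : set (set (Omega -> K^o))) :=
  exists (V : lmodType K) (S : set V) (N : set (set V)) (delta : Omega -> V)
         (T : (Omega -> K^o) -> (V -> K^o)),
    [/\ lcH S N, strong_linearisation F Ntau S N delta T, complete S N & barrelled S N].

Definition prebidual (F : set (Omega -> K^o)) (Ntau : set (set (Omega -> K^o)))
    (V : lmodType K) (S : set V) (N : set (set V))
    (phi : (Omega -> K^o) -> ((V -> K^o) -> K^o)) :=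
  lcH S N /\
  top_iso F Ntau (dual (dual S N) (strong_base S N))
                 (strong_base (dual S N) (strong_base S N)) phi.

End Functions.
End LCS.

(* Main.v *)
(* Every assertion is compared with (e).  Given (e), let [g] be the topology [gamma_base].
   A gliding-neighbourhood argument shows that [g] has the same bounded sets as [tau]; as
   these are relatively [g]-compact, [(F, g)] is semi-Montel and, by Mackey-Arens,
   semi-reflexive.  The predual is [Y = (F, g)'_b].  It is complete because [g]-continuity
   of functionals is tested on bounded sets, and barrelled because it is the strong dual of
   a semi-reflexive space: the polar of a barrel is weakly bounded, hence bounded by
   Mackey's theorem.  The evaluation [F -> Y'_b] is continuous since [tau] is bornological
   and open by (CNC) and the bipolar theorem.  Conversely, a strong barrelled linearisation
   [Y] gives (e) for the weak topology pulled back from [Y'], by the Alaoglu theorem. *)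
Require Import Defs.
From HB Require Import structures.
From mathcomp Require Import all_boot all_order all_algebra.
From mathcomp Require Import ring lra.
From mathcomp Require Import complex.
From mathcomp Require Import all_classical all_reals.
Set Implicit Arguments.
Unset Strict Implicit.
Unset Printing Implicit Defensive.
Import Order.TTheory GRing.Theory Num.Theory.
Local Open Scope ring_scope.
Local Open Scope classical_set_scope.

(** The space $F$ with the mixed topology plays two roles: its strong dual is the predual required
    in (a), and it is itself the prebidual of (b), with the same evaluation map in both. That map
    can be compared with $\tau$ only when the mixed topology has the same bounded sets as $\tau$.
    Assertions (c) and (d) assume this; (e) and (f) do not, and closing that gap is the main
    obstacle. Point evaluations enter only as elements of the dual for the mixed topology, which
    both $\tau_p\le\widetilde\tau$ and the condition in (f) provide. In (d) compact sets are not
    given, but semi-reflexivity is, and it enters the construction of the predual where compactness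
    would have produced it; hence that construction is stated for a general topology. On the way
    back to (e), barrelledness makes the image of a bounded set equicontinuous, which is what puts
    it into an Alaoglu compact set. Mackey-Arens is obtained by least squares: a bidual functional
    is interpolated exactly at finitely many functionals by a point of a compact absolutely convex
    set, and compactness then handles all functionals at once. *)

(* Common interface to [R] and [R[i]]; in the real case [im] and [ii] are zero. *)
Record scalars (R : realType) (K : numFieldType) := Scalars {
  emb : R -> K;
  re : K -> R;
  im : K -> R;
  ii : K;
  cj : K -> K;
  embD : forall a c, emb (a + c) = emb a + emb c;
  embM : forall a c, emb (a * c) = emb a * emb c;
  emb1 : emb 1 = 1;
  emb_le : forall a c, (emb a <= emb c) = (a <= c);
  scalarE : forall z, z = emb (re z) + ii * emb (im z);
  reD : forall z w, re (z + w) = re z + re w;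
  imD : forall z w, im (z + w) = im z + im w;
  re_embM : forall a z, re (emb a * z) = a * re z;
  im_embM : forall a z, im (emb a * z) = a * im z;
  re1 : re 1 = 1;
  re_ii : forall a, re (ii * emb a) = 0;
  ii_cases : ii = 0 \/ ii * ii = - 1;
  re_cj : forall z w, re (cj z * w) = re z * re w + im z * im w;
  re_normsq : forall z : K, re ((`|z| : K) ^+ 2) = re z ^+ 2 + im z ^+ 2;
  norm_embE : forall z : K, (`|z| : K) = emb (re (`|z| : K))
}.

Lemma real_scalars (R : realType) : scalars R R.
Proof.
apply: (@Scalars R R id id (fun=> 0) 0 id) => //=; try by [move=> *; ring].
- by left.
- by move=> z; rewrite real_normK ?num_real// expr0n addr0.
Qed.

Lemma complex_scalars (R : realType) : scalars R R[i].
Proof.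
apply: (@Scalars R R[i] (fun a => a%:C%C) (@complex.Re R) (@complex.Im R)
   ('i)%C (@conjc R)) => //=.
- by move=> a c; rewrite -rmorphD.
- by move=> a c; rewrite -rmorphM.
- by move=> a c; rewrite lecR.
- exact: complexE.
- by move=> [a b] [c d].
- by move=> [a b] [c d].
- by move=> a [c d] /=; rewrite mul0r subr0.
- by move=> a [c d] /=; rewrite mul0r addr0.
- by move=> a; rewrite mulr0 mul0r subrr.
- by right; rewrite -expr2 sqr_i.
- by move=> [a b] [c d] /=; ring.
- by move=> z; exact: (congr1 (@complex.Re R) (esym (add_Re2_Im2 z))).
Qed.

Definition KK_scalars (R : realType) (b : bool) : scalars R (KK R b) :=
  if b return scalars R (KK R b) then complex_scalars R else real_scalars R.

(** * Real-valued norms and limits of scalars over both fields *)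

Section Scalars.
Variables (R : realType) (K : numFieldType) (s : scalars R K).
Local Notation emb := (emb s).
Local Notation re := (re s).
Local Notation im := (im s).
Local Notation ii := (ii s).
Local Notation cj := (cj s).

(** The norm of [K] takes values in [K]; its real copy admits infima, suprema and linear
    arithmetic. *)
Definition knorm (z : K) : R := re (`|z| : K).
Local Notation nm := knorm.

Lemma emb0 : emb 0 = 0.
Proof. by apply: (addrI (emb 0)); rewrite -embD !addr0. Qed.

Lemma embN a : emb (- a) = - emb a.
Proof. by apply: (addrI (emb a)); rewrite -embD !subrr emb0. Qed.

Lemma embB a c : emb (a - c) = emb a - emb c.
Proof. by rewrite embD embN. Qed.

Lemma emb_inj : injective emb.
Proof. by move=> a c e; apply/eqP; rewrite eq_le -!(emb_le s) e lexx. Qed.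

Lemma emb_lt a c : (emb a < emb c) = (a < c).
Proof. by rewrite !lt_neqAle emb_le (inj_eq emb_inj). Qed.

Lemma emb_ge0 a : (0 <= emb a) = (0 <= a).
Proof. by rewrite -{1}emb0 emb_le. Qed.

Lemma emb_gt0 a : (0 < emb a) = (0 < a).
Proof. by rewrite -{1}emb0 emb_lt. Qed.

Lemma emb_eq0 a : (emb a == 0) = (a == 0).
Proof. by rewrite -{1}emb0 (inj_eq emb_inj). Qed.

Lemma embV a : emb a^-1 = (emb a)^-1.
Proof.
have [->|a0] := eqVneq a 0; first by rewrite !(invr0, emb0).
by apply: (mulfI (x := emb a)); rewrite ?emb_eq0// -embM !divff ?emb1 ?emb_eq0.
Qed.

Lemma embX a n : emb (a ^+ n) = emb a ^+ n.
Proof. by elim: n => [|n IH]; rewrite ?emb1// !exprS embM IH. Qed.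

Lemma emb_nat n : emb n%:R = n%:R.
Proof. by elim: n => [|n IH]; rewrite ?emb0// !mulrS embD IH emb1. Qed.

Lemma norm_emb a : (`|emb a| : K) = emb `|a|.
Proof.
have [a0|a0] := leP 0 a; first by rewrite ger0_norm ?emb_ge0// ger0_norm.
by rewrite ltr0_norm ?ltr0_norm ?embN// -emb0 emb_lt.
Qed.

Lemma re0 : re 0 = 0.
Proof. by rewrite -{1}emb0 -[emb 0]mulr1 re_embM mul0r. Qed.

Lemma im0 : im 0 = 0.
Proof. by rewrite -{1}emb0 -[emb 0]mulr1 im_embM mul0r. Qed.

Lemma reN z : re (- z) = - re z.
Proof. by apply: (addrI (re z)); rewrite -reD !subrr re0. Qed.

Lemma imN z : im (- z) = - im z.
Proof. by apply: (addrI (im z)); rewrite -imD !subrr im0. Qed.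

Lemma reB z w : re (z - w) = re z - re w.
Proof. by rewrite reD reN. Qed.

Lemma imB z w : im (z - w) = im z - im w.
Proof. by rewrite imD imN. Qed.

Lemma re_emb a : re (emb a) = a.
Proof. by rewrite -[emb a]mulr1 re_embM re1 mulr1. Qed.

Lemma emb_re (t : K) : 0 <= t -> t = emb (re t).
Proof. by move=> t0; have := norm_embE s t; rewrite ger0_norm. Qed.

Lemma nmE (z : K) : (`|z| : K) = emb (nm z).
Proof. exact: norm_embE. Qed.

Lemma nm_ge0 z : 0 <= nm z.
Proof. by rewrite -emb_ge0 -nmE. Qed.

Lemma nm_le (z : K) a : ((`|z| : K) <= emb a) = (nm z <= a).
Proof. by rewrite nmE emb_le. Qed.

Lemma nm_le1 (z : K) : ((`|z| : K) <= 1) = (nm z <= 1).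
Proof. by rewrite -(emb1 s) nm_le. Qed.

Lemma nmD z w : nm (z + w) <= nm z + nm w.
Proof. by rewrite -(emb_le s) embD -!nmE ler_normD. Qed.

Lemma nmN z : nm (- z) = nm z.
Proof. by rewrite /knorm normrN. Qed.

Lemma nmB z w : nm (z - w) <= nm z + nm w.
Proof. by rewrite -(nmN w) nmD. Qed.

Lemma nm_distC z w : nm (z - w) = nm (w - z).
Proof. by rewrite -nmN opprB. Qed.

Lemma nmM z w : nm (z * w) = nm z * nm w.
Proof. by apply: emb_inj; rewrite embM -!nmE normrM. Qed.

Lemma nm_emb a : nm (emb a) = `|a|.
Proof. by apply: emb_inj; rewrite -nmE norm_emb. Qed.

Lemma nm_eq0 z : (nm z == 0) = (z == 0).
Proof. by rewrite -emb_eq0 -nmE normr_eq0. Qed.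

Lemma nm0 : nm 0 = 0.
Proof. by apply/eqP; rewrite nm_eq0. Qed.

Lemma nmsq z : nm z ^+ 2 = re z ^+ 2 + im z ^+ 2.
Proof. by rewrite -re_normsq nmE -embX re_emb. Qed.

Lemma re_nm z : `|re z| <= nm z.
Proof.
by rewrite -ler_sqr ?nnegrE ?nm_ge0// nmsq real_normK ?num_real// lerDl sqr_ge0.
Qed.

Lemma im_nm z : `|im z| <= nm z.
Proof.
by rewrite -ler_sqr ?nnegrE ?nm_ge0// nmsq real_normK ?num_real// lerDr sqr_ge0.
Qed.

Lemma nm_subsq z w : nm (z - w) ^+ 2 = nm z ^+ 2 - 2 * re (cj z * w) + nm w ^+ 2.
Proof. by rewrite !nmsq reB imB re_cj; ring. Qed.

(** A unimodular factor turns a modulus into a real number, so over a balanced set a bound on real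
    parts is a bound on moduli. *)
Lemma nm_rotate z : exists2 u : K, nm u = 1 & u * z = emb (nm z).
Proof.
have [->|z0] := eqVneq z 0; first by exists 1; rewrite ?mulr0 ?nm0 ?emb0// -(emb1 s) nm_emb normr1.
exists (`|z| / z); last by rewrite divfK ?nmE.
by apply: emb_inj; rewrite -nmE emb1 normrM normfV normr_id divff ?normr_eq0.
Qed.

Lemma scalar_bound (t : K) : 0 <= t -> exists n : nat, t <= n%:R.
Proof.
move=> t0; exists (Num.bound (re t)).
rewrite {1}(emb_re t0) -emb_nat emb_le.
by apply/ltW/archi_boundP; rewrite -emb_ge0 -emb_re.
Qed.

(* [u x := emb (r x) - ii * emb (r (ii *: x))] is the usual complexification;
   for real scalars [ii = 0] and it reduces to [r]. *)
Lemma linear_of_re (V : lmodType K) (S : set V) (r : V -> R) : subspace S ->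
  (forall x y, S x -> S y -> r (x + y) = r x + r y) ->
  (forall a x, S x -> r (emb a *: x) = a * r x) ->
  exists u : V -> K^o, linear_on S u /\ forall x, re (u x) = r x.
Proof.
move=> [S0 Slin] rD rZ.
have SZ a x : S x -> S (a *: x) by move=> Sx; rewrite -[_ *: _]addr0; apply: Slin.
have SD x y : S x -> S y -> S (x + y) by move=> Sx; rewrite -[x]scale1r; apply: Slin.
pose u x := emb (r x) - ii * emb (r (ii *: x)).
have uD x y : S x -> S y -> u (x + y) = u x + u y.
  by move=> Sx Sy; rewrite /u scalerDr (rD _ _ Sx Sy) (rD _ _ (SZ _ _ Sx) (SZ _ _ Sy)) !embD; ring.
have uZ a x : S x -> u (emb a *: x) = emb a * u x.
  move=> Sx; rewrite /u scalerA [ii * emb a]mulrC -scalerA (rZ _ _ Sx) (rZ _ _ (SZ _ _ Sx)) !embM; ring.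
have ui x : S x -> u (ii *: x) = ii * u x.
  move=> Sx; rewrite /u scalerA; have [->|i2] := ii_cases s.
    by rewrite !mul0r !scale0r subr0 -(scale0r x) -emb0 rZ// mul0r emb0.
  rewrite i2; have -> : (- 1 : K) = emb (- 1) by rewrite embN emb1.
  rewrite rZ// mulrBr mulrA i2 mulN1r mulN1r embN; ring.
exists u; split; last by move=> x; rewrite /u reB re_emb re_ii subr0.
move=> a x y Sx Sy; rewrite (uD _ _ (SZ _ _ Sx) Sy); congr (_ + _).
rewrite [in LHS](scalarE s a) scalerDl (uD _ _ (SZ _ _ Sx) (SZ _ _ Sx)).
rewrite [ii * _]mulrC -scalerA (uZ _ _ Sx) (uZ _ _ (SZ _ _ Sx)) (ui _ Sx).
by rewrite {3}(scalarE s a) /GRing.scale /=; ring.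
Qed.

Section UltraLimits.
Variables (T : Type) (U : set_system T).
Hypothesis UU : UltraFilter U.

(** The limit is the supremum of the [x] with [x <= f] on a member of [U]; above it the ultrafilter
    must contain the opposite inequality. *)
Lemma real_ultra_lim (f : T -> R) M : U [set t | `|f t| <= M] ->
  exists l, forall e, 0 < e -> U [set t | `|f t - l| <= e].
Proof.
move=> UM; pose A := [set x | U [set t | x <= f t]].
have sA : has_sup A; first split.
- by exists (- M); apply: filterS UM => t /=; rewrite ler_norml => /andP[].
- exists M => x Ax; have [t [/= xt]] := filter_ex (filterI Ax UM).
  by rewrite ler_norml => /andP[_]; exact: le_trans.
exists (sup A) => e e0.
have U1 : U [set t | sup A - e <= f t].
  have [x Ax xl] := sup_adherent e0 sA.
  by apply: filterS Ax => t /=; apply: le_trans; exact: ltW.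
have U2 : U [set t | f t <= sup A + e].
  have [Ae|] := in_ultra_setVsetC [set t | sup A + e <= f t] UU.
    by have /(_ _ Ae) := sup_upper_bound sA; rewrite leNgt ltrDl e0.
  by apply: filterS => t /= /negP; rewrite -ltNge; exact: ltW.
apply: filterS (filterI U1 U2) => t /= [t1 t2].
by rewrite ler_norml; lra.
Qed.

Lemma ultra_lim (f : T -> K) (M : R) : U [set t | nm (f t) <= M] ->
  exists l, forall e, 0 < e -> U [set t | nm (f t - l) <= e].
Proof.
move=> UM.
have [a Ha] : exists l, forall e, 0 < e -> U [set t | `|re (f t) - l| <= e].
  apply: (@real_ultra_lim _ M).
  by apply: filterS UM => t /=; apply: le_trans; exact: re_nm.
have [c Hc] : exists l, forall e, 0 < e -> U [set t | `|im (f t) - l| <= e].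
  apply: (@real_ultra_lim _ M).
  by apply: filterS UM => t /=; apply: le_trans; exact: im_nm.
exists (emb a + ii * emb c) => e e0.
(* The weight [1 + nm ii] serves both scalar fields and spares computing the norm of [ii]. *)
have n0 : 0 < 1 + nm ii by rewrite ltr_pwDl// nm_ge0.
have d0 : 0 < e / (1 + nm ii) by rewrite divr_gt0.
apply: filterS (filterI (Ha _ d0) (Hc _ d0)) => t /= [h1 h2].
rewrite [f t](scalarE s).
have -> : emb (re (f t)) + ii * emb (im (f t)) - (emb a + ii * emb c) =
  emb (re (f t) - a) + ii * emb (im (f t) - c) by rewrite !embB; ring.
apply: le_trans (nmD _ _) _; rewrite nmM !nm_emb.
apply: (@le_trans _ _ ((e / (1 + nm ii)) * (1 + nm ii))); last by rewrite divfK ?gt_eqF.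
by rewrite mulrDr mulr1 lerD// mulrC ler_wpM2r// nm_ge0.
Qed.

Lemma ultra_lim_le (f : T -> K) l c M : (forall e, 0 < e -> U [set t | nm (f t - l) <= e]) ->
  U [set t | nm (f t - c) <= M] -> nm (l - c) <= M.
Proof.
move=> fl fM; apply/ler_addgt0Pr => e e0.
have [t [/= h1 h2]] := filter_ex (filterI (fl _ e0) fM).
have -> : l - c = (f t - c) - (f t - l) by ring.
by apply: le_trans (nmB _ _) _; exact: lerD.
Qed.

End UltraLimits.
End Scalars.

(** * Locally convex spaces and compactness by ultrafilters *)

Section AbsConvex.
Variables (K : numFieldType) (V : lmodType K).
Implicit Types (A B : set V) (x y : V).

Lemma ac_scale A (a : K) x : absconvex A -> `|a| <= 1 -> A x -> A (a *: x).
Proof.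
move=> cA a1 Ax; have := cA a 0 x x Ax Ax.
by rewrite scale0r addr0 normr0 addr0; exact.
Qed.

Lemma ac0 A x : absconvex A -> A x -> A 0.
Proof. by move=> cA Ax; rewrite -(scale0r x); apply: ac_scale; rewrite ?normr0. Qed.

Lemma acN A x : absconvex A -> A x -> A (- x).
Proof. by move=> cA Ax; rewrite -scaleN1r; apply: ac_scale; rewrite ?normrN1. Qed.

Lemma scale_setP A (t : K) x : t != 0 -> scale_set t A x <-> A (t^-1 *: x).
Proof.
move=> t0; split=> [[y Ay <-]|Ax]; first by rewrite scalerA mulVf// scale1r.
by exists (t^-1 *: x) => //; rewrite scalerA divff// scale1r.
Qed.

Lemma scale_set_le A (a c : K) : absconvex A -> `|a| <= `|c| ->
  scale_set a A `<=` scale_set c A.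
Proof.
move=> cA ac _ [x Ax <-]; have [c0|c0] := eqVneq c 0.
  move: ac; rewrite c0 normr0 normr_le0 => /eqP ->.
  by exists x.
apply/scale_setP => //; rewrite scalerA; apply: ac_scale => //.
by rewrite normrM normfV mulrC ler_pdivrMr ?normr_gt0// mul1r.
Qed.

Lemma ac_comb A (a c t1 t2 T : K) x y : absconvex A -> 0 <= t1 -> 0 <= t2 ->
  scale_set t1 A x -> scale_set t2 A y -> 0 < T -> `|a| * t1 + `|c| * t2 <= T ->
  scale_set T A (a *: x + c *: y).
Proof.
move=> cA t10 t20 [x' Ax <-] [y' Ay <-] T0 le.
exists ((a * t1 / T) *: x' + (c * t2 / T) *: y').
  apply: cA => //; rewrite !normrM !normfV (ger0_norm t10) (ger0_norm t20) (gtr0_norm T0).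
  by rewrite -mulrDl ler_pdivrMr// mul1r.
rewrite scalerDr !scalerA; congr (_ *: _ + _ *: _); rewrite mulrC divfK ?gt_eqF//.
Qed.

Lemma absorbsW A B (t : K) : absconvex A -> 0 < t -> B `<=` scale_set t A ->
  absorbs A B.
Proof.
move=> cA t0 BA; exists t; split=> // s ts x /BA.
by apply: scale_set_le => //; rewrite gtr0_norm.
Qed.

Lemma absorbsE A B : absorbs A B -> exists t : K, 0 < t /\ B `<=` scale_set t A.
Proof. by move=> [t [t0 H]]; exists t; split=> //; apply: H; rewrite gtr0_norm. Qed.

Lemma absorbsS A A' B B' : A `<=` A' -> B' `<=` B -> absorbs A B -> absorbs A' B'.
Proof.
move=> AA BB [t [t0 H]]; exists t; split=> // s ts x /BB /(H s ts) [y Ay <-].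
by exists y => //; exact: AA.
Qed.

Lemma ac_scale_set A (t : K) : absconvex A -> absconvex (scale_set t A).
Proof.
move=> cA a c _ _ [x Ax <-] [y Ay <-] ac; exists (a *: x + c *: y); first exact: cA.
by rewrite scalerDr !scalerA ![t * _]mulrC.
Qed.

Lemma acI A B : absconvex A -> absconvex B -> absconvex (A `&` B).
Proof. by move=> cA cB a c x y [? ?] [? ?] ac; split; [exact: cA|exact: cB]. Qed.

Lemma translateP a A x : translate a A x <-> A (x - a).
Proof.
split=> [[u Au <-]|Ax]; first by rewrite addrC addKr.
by exists (x - a) => //; rewrite addrC subrK.
Qed.

End AbsConvex.

Section LinearOn.
Variables (K : numFieldType) (V W : lmodType K) (S : set V) (f : V -> W).
Hypotheses (HS : subspace S) (lf : linear_on S f).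

Lemma subspace0 : S 0. Proof. by case: HS. Qed.

Lemma subspaceZ (a : K) x : S x -> S (a *: x).
Proof. by case: HS => S0 H Sx; rewrite -[_ *: _]addr0; exact: H. Qed.

Lemma subspaceD x y : S x -> S y -> S (x + y).
Proof. by case: HS => S0 H Sx Sy; rewrite -[x]scale1r; exact: H. Qed.

Lemma subspaceN x : S x -> S (- x).
Proof. by move=> Sx; rewrite -scaleN1r; exact: subspaceZ. Qed.

Lemma subspaceB x y : S x -> S y -> S (x - y).
Proof. by move=> Sx Sy; apply: subspaceD => //; exact: subspaceN. Qed.

Lemma linear_onD x y : S x -> S y -> f (x + y) = f x + f y.
Proof. by move=> Sx Sy; rewrite -{1}[x]scale1r lf// scale1r. Qed.

Lemma linear_on0 : f 0 = 0.
Proof. by apply: (addrI (f 0)); rewrite -(linear_onD subspace0 subspace0) !addr0. Qed.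

Lemma linear_onZ a x : S x -> f (a *: x) = a *: f x.
Proof. by move=> Sx; rewrite -[_ *: x]addr0 (lf a Sx subspace0) linear_on0 addr0. Qed.

Lemma linear_onN x : S x -> f (- x) = - f x.
Proof. by move=> Sx; rewrite -scaleN1r linear_onZ// scaleN1r. Qed.

Lemma linear_onB x y : S x -> S y -> f (x - y) = f x - f y.
Proof. by move=> Sx Sy; rewrite linear_onD ?linear_onN//; exact: subspaceN. Qed.

End LinearOn.

Lemma absconvex_subspace (K : numFieldType) (V : lmodType K) (S : set V) :
  subspace S -> absconvex S.
Proof. by move=> HS a c x y Sx Sy _; apply: subspaceD => //; exact: subspaceZ. Qed.

Section LocallyConvex.
Variables (K : numFieldType) (V : lmodType K) (S : set V) (N : set (set V)).
Hypothesis HN : lcH S N.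
Implicit Types (A B C U W : set V) (x y : V).

Lemma lc_subspace : subspace S. Proof. by case: HN => -[]. Qed.
Local Notation HS := lc_subspace.

Lemma lc_sub U : N U -> U `<=` S. Proof. by case: HN => _ H _ _ _ /H []. Qed.

Lemma lc_ac U : N U -> absconvex U. Proof. by case: HN => _ H _ _ _ /H []. Qed.

Lemma lc_absorbing U : N U -> absorbing S U.
Proof. by case: HN => _ H _ _ _ /H []. Qed.

Lemma lc0 U : N U -> U 0.
Proof.
move=> NU; have /absorbsE [t [t0 H]] := lc_absorbing NU (subspace0 HS).
by have [x Ux _] := H 0 erefl; apply: ac0 Ux; exact: lc_ac.
Qed.

Lemma lc_half U : N U -> exists W, N W /\ forall x y, W x -> W y -> U (x + y).
Proof.
move=> NU; have [W [NW WU]] : exists W, N W /\ scale_set 2 W `<=` U by case: HN => _ _ _ /(_ _ NU).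
exists W; split=> // x y Wx Wy; apply: WU.
exists (2^-1 *: x + 2^-1 *: y); last first.
  by rewrite scalerDr !scalerA divff ?pnatr_eq0// !scale1r.
apply: (lc_ac NW) => //; rewrite normfV ger0_norm ?ler0n//.
by rewrite le_eqVlt; apply/orP; left; apply/eqP; field.
Qed.

Lemma lc_inter U1 U2 : N U1 -> N U2 -> exists W, N W /\ W `<=` U1 `&` U2.
Proof. by case: HN => _ _ H _ _; exact: H. Qed.

(** [lcH] provides halving only: iteration reaches the factor [2 ^+ n], and absolute convexity
    covers [n], which is smaller. *)
Lemma lc_nat U n : N U -> exists W, N W /\ forall x, W x -> U (n%:R *: x).
Proof.
move=> NU; suff [W [NW H]] : exists W, N W /\ forall x, W x -> U ((2 ^+ n) *: x).
  exists W; split=> // x /H Ux.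
  rewrite -[n%:R](@divfK _ (2 ^+ n)) ?expf_neq0 ?pnatr_eq0// -scalerA.
  apply: ac_scale Ux; first exact: lc_ac.
  rewrite normrM normfV !ger0_norm ?ler0n ?exprn_ge0 ?ler0n// ler_pdivrMr ?exprn_gt0 ?ltr0n//.
  by rewrite mul1r -natrX ler_nat ltnW// ltn_expl.
elim: n => [|n [W [NW H]]]; first by exists U; split=> // x; rewrite scale1r.
have [W' [NW' H']] := lc_half NW; exists W'; split=> // x Wx.
by rewrite exprSr -scalerA; apply: H; rewrite -[2]/(1 + 1) scalerDl scale1r; apply: H'.
Qed.

Lemma bounded_sub B : bounded S N B -> B `<=` S. Proof. by case. Qed.

Lemma boundedS B B' : B' `<=` B -> bounded S N B -> bounded S N B'.
Proof.
move=> BB [BS H]; split; first exact: subset_trans BS.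
by move=> U /H; exact: absorbsS.
Qed.

Lemma bounded1 x : S x -> bounded S N [set x].
Proof. by move=> Sx; split=> [_ ->//|U /lc_absorbing]; exact. Qed.

Lemma bounded_comb (a c : K) B1 B2 : bounded S N B1 -> bounded S N B2 ->
  bounded S N [set z | exists x y, [/\ B1 x, B2 y & z = a *: x + c *: y]].
Proof.
move=> [S1 H1] [S2 H2]; split=> [_ [x [y [/S1 Sx /S2 Sy ->]]]|U NU].
  by apply: (subspaceD HS); exact: (subspaceZ HS).
have /absorbsE [t [t0 Ht]] := H1 _ NU.
have /absorbsE [t' [t0' Ht']] := H2 _ NU.
pose T := `|a| * t + `|c| * t' + 1.
have T0 : 0 < T by rewrite ltr_wpDl// addr_ge0// mulr_ge0// ltW.
apply: (absorbsW (t := T)) => //; first exact: lc_ac.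
move=> _ [x [y [/Ht Ux /Ht' Uy ->]]].
by apply: ac_comb Ux Uy _ _; rewrite ?(ltW t0) ?(ltW t0') ?lerDl//; exact: lc_ac.
Qed.

(** [coincide_on] compares neighbourhoods only at points of the set; adjoining 0 makes
    neighbourhoods of the origin available. *)
Lemma bounded0U B : bounded S N B -> bounded S N (0 |` B).
Proof.
move=> [BS H]; split=> [x [->|/BS//]|U NU]; first exact: (subspace0 HS).
have /absorbsE [t [t0 Ht]] := H _ NU.
apply: (absorbsW (t := t)) => //; first exact: lc_ac.
by move=> x [->|/Ht//]; exists 0; rewrite ?scaler0//; exact: lc0.
Qed.

Lemma boundedU B1 B2 : bounded S N B1 -> bounded S N B2 -> bounded S N (B1 `|` B2).
Proof.
move=> b1 b2; apply: boundedS (bounded_comb 1 1 (bounded0U b1) (bounded0U b2)).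
move=> x [Bx|Bx].
  by exists x, 0; split; [right|left|rewrite scaler0 scale1r addr0].
by exists 0, x; split; [left|right|rewrite scaler0 scale1r add0r].
Qed.

Lemma bounded_scale (a : K) B : bounded S N B -> bounded S N (scale_set a B).
Proof.
move=> b; apply: boundedS (bounded_comb a 0 b b) => _ [x Bx <-].
by exists x, x; rewrite scale0r addr0.
Qed.

Lemma bounded_diff a B : S a -> bounded S N B -> bounded S N [set x - a | x in B].
Proof.
move=> Sa b; apply: boundedS (bounded_comb 1 (-1) b (bounded1 Sa)) => _ [x Bx <-].
by exists x, a; rewrite scale1r scaleN1r.
Qed.

Definition acx_hull B : set V := [set x | forall A, absconvex A -> B `<=` A -> A x].

Lemma acx_hull_ac B : absconvex (acx_hull B).
Proof. by move=> a c x y Bx By ac A cA BA; exact: (cA _ _ _ _ (Bx A cA BA) (By A cA BA) ac). Qed.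

Lemma sub_acx_hull B : B `<=` acx_hull B.
Proof. by move=> x Bx A _; exact. Qed.

Lemma bounded_acx_hull B : bounded S N B -> bounded S N (acx_hull B).
Proof.
move=> [BS H]; split=> [x Bx|U NU].
  by apply: (Bx S) => //; exact: (absconvex_subspace HS).
have /absorbsE [t [t0 Ht]] := H _ NU.
apply: (absorbsW (t := t)) => //; first exact: lc_ac.
by move=> x Bx; apply: (Bx _ _ Ht); apply: ac_scale_set; exact: lc_ac.
Qed.

Lemma closure_ac A : absconvex A -> absconvex (Defs.closure S N A).
Proof.
move=> cA a c x y [Sx Hx] [Sy Hy] ac; split.
  by apply: (subspaceD HS); exact: (subspaceZ HS).
move=> U NU; have [u [Uu Au]] := Hx _ NU; have [v [Uv Av]] := Hy _ NU.
exists (a *: u + c *: v); split; first exact: (lc_ac NU).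
by rewrite addrACA -!scalerDr; exact: cA.
Qed.

Lemma sub_closure A : A `<=` S -> A `<=` Defs.closure S N A.
Proof.
by move=> AS x Ax; split=> [|U NU]; [exact: AS|exists 0; rewrite addr0; split=> //; exact: lc0].
Qed.

Lemma is_closed_closure A : is_closed S N (Defs.closure S N A).
Proof.
split=> [x []//|a Sa nA].
have [U [NU HU]] : exists U, N U /\ forall u, U u -> ~ A (a + u).
  apply: contrapT => H; apply: nA; split=> // U NU; apply: contrapT => H'.
  by apply: H; exists U; split=> // u Uu Au; apply: H'; exists u.
have [W [NW HW]] := lc_half NU; exists W; split=> //.
apply/seteqP; split=> // x [[w Ww <-] [_ /(_ _ NW) [w' [Ww' Aw]]]].
by apply: (HU (w + w')); [exact: HW|rewrite addrA].
Qed.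

Lemma closure_sub A C : A `<=` C -> is_closed S N C -> Defs.closure S N A `<=` C.
Proof.
move=> AC [CS cC] x [Sx Hx]; apply: contrapT => nC.
have [U [NU /seteqP [H _]]] := cC _ Sx nC; have [u [Uu /AC Cu]] := Hx _ NU.
by apply: (H (x + u)); split=> //; exists u.
Qed.

(** If [G] had no limit in [C], the open sets outside [G] would cover [C]; a finite subcover would
    belong to [G], hence so would one of its members. *)
Lemma compact_ultra C : is_compact S N C -> forall G, UltraFilter G -> G C ->
  exists2 a, C a & converges N G a.
Proof.
move=> [CS cC] G UG GC; apply: contrapT => H.
have H1 a : C a -> exists U, N U /\ ~ G (translate a U).
  move=> Ca; apply: contrapT => H1; apply: H; exists a => // U NU.
  by apply: contrapT => nG; apply: H1; exists U.
pose O := [set A | is_open S N A /\ ~ G A].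
have [|x Cx|s [sO sC]] := cC O; first by move=> A [].
  have [U [NU nG]] := H1 _ Cx.
  (* A translate of a basic neighbourhood need not be open, so its interior is taken. *)
  exists [set y | S y /\ exists W, N W /\ translate y W `<=` translate x U].
  split; last by split; [exact: CS|exists U; split].
  split; last first.
    move=> GA; apply: nG; apply: filterS GA => y [Sy [W [NW /(_ y)]]]; apply.
    by apply/translateP; rewrite subrr; exact: lc0.
  split=> [y []//|y [Sy [W [NW HW]]]].
  have [W' [NW' HW']] := lc_half NW; exists W'; split=> // _ [w Ww <-]; split.
    by apply: (subspaceD HS) => //; exact: lc_sub Ww.
  exists W'; split=> // _ [w' Ww' <-]; apply: HW; apply/translateP.
  by rewrite addrAC [y + w]addrC addrK; exact: HW'.
have : G [set x | exists A, List.In A s /\ A x] by exact: filterS GC.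
elim: s sO {sC} => [_|A s IH sO].
  move=> G0; have [x [A [[]]]] := filter_ex G0.
have [GA|GA] := in_ultra_setVsetC A UG.
  by have [] := sO A (or_introl erefl).
move=> GH; apply: IH => [B Bs|]; first by apply: sO; right.
by apply: filterS (filterI GA GH) => x [/= nA [B [[<-//|Bs] Bx]]]; exists B.
Qed.

(** Without a finite subcover, the traces on [C] of complements of finite unions generate a proper
    filter. The limit of a finer ultrafilter lies in a member of the cover whose complement is in
    the ultrafilter too. *)
Lemma ultra_compact C : C `<=` S -> (forall G, UltraFilter G -> G C ->
  exists2 a, C a & converges N G a) -> is_compact S N C.
Proof.
move=> CS H; split=> // O Oo CO; apply: contrapT => nfin.
pose D := [set s : seq (set V) | forall A, List.In A s -> O A].
pose B (s : seq (set V)) := [set x | C x /\ forall A, List.In A s -> ~ A x].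
have FF : Filter (filter_from D B).
  apply: filter_from_filter; first by exists [::] => A [].
  move=> s t Ds Dt; exists (s ++ t).
    by move=> A /List.in_app_iff [/Ds|/Dt].
  by move=> x [Cx Hx]; split; split=> // A As; apply: Hx; apply/List.in_app_iff; [left|right].
have PF : ProperFilter (filter_from D B).
  apply: filter_from_proper => s Ds; apply: contrapT => nB; apply: nfin.
  exists s; split=> // x Cx; apply: contrapT => nA; apply: nB; exists x; split=> // A As Ax.
  by apply: nA; exists A.
have [G [UG FG]] := ultraFilterLemma PF.
have GC : G C by apply: FG; exists [::] => [A []|x []].
have [a Ca cva] := H _ UG GC; have [A [OA Aa]] := CO _ Ca.
have [_ /(_ _ Aa) [U [NU UA]]] := Oo _ OA.
have GA : G A by apply: filterS (cva _ NU).
have GnA : G (~` A).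
  by apply: FG; exists [:: A] => [A' [<-|[]]//|x [_ Hx]]; apply: Hx; left.
by have [x []] := filter_ex (filterI GA GnA).
Qed.

Lemma converges_unique (G : set_system V) a c : UltraFilter G ->
  S a -> S c -> converges N G a -> converges N G c -> a = c.
Proof.
move=> UG Sa Sc Ha Hc; apply/eqP; rewrite -subr_eq0; apply: contrapT => /negP ac.
have [U [NU nU]] : exists U, N U /\ ~ U (a - c).
  by case: HN => _ _ _ _; apply => //; exact: (subspaceB HS).
have [W [NW HW]] := lc_half NU; apply: nU.
have [x [/translateP xa /translateP xc]] := filter_ex (filterI (Ha _ NW) (Hc _ NW)).
rewrite -(subrK x a) -addrA; apply: HW => //.
by rewrite -opprB; apply: acN => //; exact: lc_ac.
Qed.

(** A point all of whose neighbourhoods meet [C] is the limit of an ultrafilter on [C]; uniqueness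
    of limits puts it into [C]. *)
Lemma compact_closed C : is_compact S N C -> is_closed S N C.
Proof.
move=> kC; have CS : C `<=` S by case: kC.
split=> // a Sa nC; apply: contrapT => H.
pose B U := [set x | C x /\ U (x - a)].
have FF : Filter (filter_from N B).
  apply: filter_from_filter; first by case: HN => -[].
  move=> U W NU NW; have [U' [NU' HU]] := lc_inter NU NW; exists U' => //.
  by move=> x [Cx /HU[]].
have PF : ProperFilter (filter_from N B).
  apply: filter_from_proper => U NU; apply: contrapT => nB; apply: H; exists U; split=> //.
  apply/seteqP; split=> // x [/translateP xU Cx]; apply: nB; exists x; split=> //.
have [G [UG FG]] := ultraFilterLemma PF.
have GC : G C.
  have [U NU] : exists U, N U by case: HN => -[].
  by apply: FG; exists U => // x [].
have [c Cc Hc] := compact_ultra kC UG GC.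
suff ac : a = c by apply: nC; rewrite ac.
apply: (converges_unique UG) Hc => //; first exact: CS.
by move=> U NU; apply: FG; exists U => // x [_ ?]; apply/translateP.
Qed.

Lemma closed_compact A C : A `<=` C -> is_closed S N A -> is_compact S N C ->
  is_compact S N A.
Proof.
move=> AC [AS cA] kC; apply: ultra_compact => // G UG GA.
have [a Ca Ha] := compact_ultra kC UG (filterS AC GA).
exists a => //; apply: contrapT => nA.
have [CS _] := kC; have [U [NU HU]] := cA _ (CS _ Ca) nA.
by have [x] := filter_ex (filterI (Ha _ NU) GA); rewrite HU.
Qed.

End LocallyConvex.

(** * The Hahn-Banach theorem *)

Section HahnBanach.
Variables (R : realType) (K : numFieldType) (s : scalars R K).
Variables (V : lmodType K) (S : set V).
Hypothesis HS : subspace S.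
Local Notation emb := (emb s).
Local Notation nm := (knorm s).

(** Homogeneity is asked as an inequality for positive real factors; applying it to the inverse
    factor gives equality. *)
Definition sublinear (q : V -> R) :=
  (forall x y, S x -> S y -> q (x + y) <= q x + q y) /\
  (forall a x, 0 < a -> S x -> q (emb a *: x) <= a * q x).

Lemma sublinearZ q a x : sublinear q -> 0 < a -> S x -> q (emb a *: x) = a * q x.
Proof.
move=> [_ qZ] a0 Sx; apply/eqP; rewrite eq_le qZ//= -ler_pdivlMl//.
apply: le_trans (qZ _ _ _ _); rewrite ?invr_gt0//; last exact: subspaceZ.
by rewrite scalerA -embM mulVf ?gt_eqF// emb1 scale1r.
Qed.

Lemma sublinear0 q : sublinear q -> q 0 = 0.
Proof.
move=> qs; have := sublinearZ qs (ltr0Sn R 1) (subspace0 HS).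
by rewrite scaler0 => h; lra.
Qed.

Lemma sublinearN_ge q x : sublinear q -> S x -> - q (- x) <= q x.
Proof.
move=> qs Sx; have [qD _] := qs; have := qD _ _ Sx (subspaceN HS Sx).
by rewrite subrr (sublinear0 qs) => h; lra.
Qed.

(** This stays sublinear and below [q], and sends [- x] to at most [- q x]. If it cannot lie
    strictly below [q] anywhere, then [q (- x) = - q x]. The infimum is finite because [t * q x] is
    at most [q (y + t x) + q (- y)]. *)
Definition tilt (q : V -> R) x y :=
  inf [set q (y + emb t *: x) - t * q x | t in [set t | 0 <= t]].

Lemma tilt_lb q x y : sublinear q -> S x -> S y ->
  lbound [set q (y + emb t *: x) - t * q x | t in [set t | 0 <= t]] (- q (- y)).
Proof.
move=> qs Sx Sy _ [t /= t0 <-].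
have tx : t * q x = q (emb t *: x).
  have [->|tn0] := eqVneq t 0; first by rewrite mul0r emb0 scale0r sublinear0.
  by rewrite sublinearZ// lt_neqAle eq_sym tn0.
have [qD _] := qs.
have := qD (y + emb t *: x) (- y).
rewrite addrAC subrr add0r tx => h; have := h _ _.
have Sn := subspaceN HS Sy; have Stx := subspaceZ HS (emb t) Sx.
by move=> /(_ (subspaceD HS Sy Stx) Sn); lra.
Qed.

Lemma tilt_le q x y t : sublinear q -> S x -> S y -> 0 <= t ->
  tilt q x y <= q (y + emb t *: x) - t * q x.
Proof.
move=> qs Sx Sy t0; apply: ge_inf; last by exists t.
by exists (- q (- y)); exact: tilt_lb.
Qed.

Lemma tilt_ge q x y c : (forall t, 0 <= t -> c <= q (y + emb t *: x) - t * q x) ->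
  c <= tilt q x y.
Proof.
move=> H; apply: lb_le_inf; last by move=> _ [t t0 <-]; exact: H.
by exists (q (y + emb 0 *: x) - 0 * q x); exists 0 => /=.
Qed.

Lemma tilt_sublinear q x : sublinear q -> S x -> sublinear (tilt q x).
Proof.
move=> qs Sx; have [qD _] := qs; split=> [y z Sy Sz|a y a0 Sy].
  rewrite -lerBlDr; apply: tilt_ge => t t0; rewrite lerBlDr -lerBlDl.
  apply: tilt_ge => t' t'0; rewrite lerBlDr.
  apply: le_trans (tilt_le qs Sx (subspaceD HS Sy Sz) (addr_ge0 t0 t'0)) _.
  rewrite embD scalerDl addrACA.
  have := qD _ _ (subspaceD HS Sy (subspaceZ HS (emb t) Sx))
    (subspaceD HS Sz (subspaceZ HS (emb t') Sx)).
  by move: (q (y + _)) (q (z + _)) (q (_ + _)) => *; lra.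
rewrite -ler_pdivrMl//; apply: tilt_ge => t t0; rewrite ler_pdivrMl//.
apply: le_trans (tilt_le qs Sx (subspaceZ HS _ Sy) (mulr_ge0 (ltW a0) t0)) _.
rewrite embM -scalerA -scalerDr sublinearZ//; first by rewrite mulrBr mulrA.
by apply: subspaceD => //; exact: subspaceZ.
Qed.

Lemma tilt_le_self q x y : sublinear q -> S x -> S y -> tilt q x y <= q y.
Proof.
move=> qs Sx Sy; have := tilt_le qs Sx Sy (lexx 0).
by rewrite emb0 scale0r addr0 mul0r subr0.
Qed.

Lemma tiltN q x : sublinear q -> S x -> tilt q x (- x) <= - q x.
Proof.
move=> qs Sx; have := tilt_le qs Sx (subspaceN HS Sx) ler01.
by rewrite emb1 scale1r addNr sublinear0// mul1r sub0r.
Qed.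

(** Zorn's lemma for the reversed pointwise order; the lower bound of a chain is its pointwise
    infimum. *)
Lemma minimal_sublinear p : sublinear p -> exists q, [/\ sublinear q,
  forall x, S x -> q x <= p x &
  forall q', sublinear q' -> (forall x, S x -> q' x <= q x) ->
    forall x, S x -> q x <= q' x].
Proof.
move=> ps; pose T := {q : V -> R | sublinear q /\ forall x, S x -> q x <= p x}.
pose r (q1 q2 : T) := `[< forall x, S x -> sval q2 x <= sval q1 x >].
have t0 : T by exists p; split.
have [|q1 q2 q3 /asboolP h1 /asboolP h2|A tA|q qmin] := @ZL_preorder T t0 r.
- by move=> q; apply/asboolP.
- by apply/asboolP => x Sx; apply: le_trans (h1 _ Sx); exact: h2.
- have [[q0 Aq0]|A0] := pselect (exists q, A q); last first.
    by exists t0 => q Aq; case: A0; exists q.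
  pose E x := [set sval q x | q in A].
  have lbE x : S x -> has_lbound (E x).
    move=> Sx; exists (- p (- x)) => _ [[q [qs qp]] _ <-] /=.
    apply: le_trans (sublinearN_ge qs Sx); rewrite lerN2; apply: qp.
    exact: subspaceN.
  have infle q x : A q -> S x -> inf (E x) <= sval q x.
    by move=> Aq Sx; apply: ge_inf; [exact: lbE|exists q].
  have infge x c : (forall q, A q -> c <= sval q x) -> c <= inf (E x).
    move=> H; apply: lb_le_inf; first by exists (sval q0 x); exists q0.
    by move=> _ [q Aq <-]; exact: H.
  have iS : sublinear (fun x => inf (E x)).
    split=> [x y Sx Sy|a x a0 Sx].
      rewrite -lerBlDr; apply: (infge _ _) => q1 Aq1; rewrite lerBlDr -lerBlDl.
      apply: (infge _ _) => q2 Aq2; rewrite lerBlDr.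
      have Sxy := subspaceD HS Sx Sy.
      (* Two members of the chain are comparable, so the smaller one bounds the infimum at [x + y]
         and its own subadditivity suffices. *)
      have [/asboolP h|/asboolP h] := tA _ _ Aq1 Aq2.
        apply: le_trans (infle _ _ Aq2 Sxy) _; have [[qD _] _] := svalP q2.
        by apply: le_trans (qD _ _ Sx Sy) _; rewrite addrC lerD2l h.
      apply: le_trans (infle _ _ Aq1 Sxy) _; have [[qD _] _] := svalP q1.
      by apply: le_trans (qD _ _ Sx Sy) _; rewrite addrC lerD2r h.
    rewrite -ler_pdivrMl//; apply: (infge _ _) => q Aq; rewrite ler_pdivrMl//.
    have [qs _] := svalP q; rewrite -sublinearZ//; apply: infle => //.
    exact: subspaceZ.
  have ip x : S x -> inf (E x) <= p x.
    move=> Sx; apply: le_trans (infle _ _ Aq0 Sx) _.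
    by have [_] := svalP q0; exact.
  exists (exist _ (fun x => inf (E x)) (conj iS ip)) => q Aq.
  by apply/asboolP => x Sx /=; exact: infle.
exists (sval q); have [qs qp] := svalP q; split=> // q' q's q'q.
have q'p x : S x -> q' x <= p x.
  by move=> Sx; apply: le_trans (q'q _ Sx) (qp _ Sx).
have := qmin (exist _ q' (conj q's q'p)).
by move=> H; apply/asboolP; apply: H; exact/asboolP.
Qed.

(* A minimal sublinear functional is linear, since it cannot be lowered by [tilt]. *)
Lemma hahn_banach_real p x : sublinear p -> S x -> exists r : V -> R,
  [/\ forall y z, S y -> S z -> r (y + z) = r y + r z,
      forall a y, S y -> r (emb a *: y) = a * r y,
      forall y, S y -> r y <= p y & p x <= r x].
Proof.
(* Minimising below [tilt p x] rather than [p] forces [r (- x) <= - p x], that is [p x <= r x] once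
   [r] is odd. *)
move=> ps Sx; have [r [rs rp rmin]] := minimal_sublinear (tilt_sublinear ps Sx).
have rN y : S y -> r (- y) = - r y.
  move=> Sy; apply/eqP; rewrite eq_le; apply/andP; split; last first.
    by have := sublinearN_ge rs Sy; lra.
  apply: le_trans (tiltN rs Sy); apply: rmin; last exact: subspaceN.
    exact: tilt_sublinear.
  by move=> z Sz; exact: tilt_le_self.
have rpp y : S y -> r y <= p y.
  by move=> Sy; apply: le_trans (rp _ Sy) (tilt_le_self ps Sx Sy).
exists r; split=> //.
- move=> y z Sy Sz; have [rD _] := rs; apply/eqP; rewrite eq_le rD//=.
  have := rD _ _ (subspaceN HS Sy) (subspaceN HS Sz).
  by rewrite -opprD !rN//; [lra|exact: subspaceD].
- move=> a y Sy; have [a0|a0|<-] := ltgtP 0 a; first exact: sublinearZ.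
    have -> : emb a *: y = - (emb (- a) *: y) by rewrite embN scaleNr opprK.
    rewrite rN; last exact: subspaceZ.
    by rewrite sublinearZ ?oppr_gt0// mulNr opprK.
  by rewrite emb0 scale0r mul0r sublinear0.
- have := rp _ (subspaceN HS Sx); rewrite rN// => h.
  have := tiltN ps Sx; lra.
Qed.

Section Gauge.
Variable G : set V.
Hypotheses (cG : absconvex G) (aG : absorbing S G).

Definition gauge y := inf [set t | 0 < t /\ G (emb t^-1 *: y)].

Lemma gauge_lb y : lbound [set t | 0 < t /\ G (emb t^-1 *: y)] 0.
Proof. by move=> t [/ltW]. Qed.

Lemma gauge_ne y : S y -> [set t | 0 < t /\ G (emb t^-1 *: y)] !=set0.
Proof.
move=> Sy; have /absorbsE [t [t0 H]] := aG Sy.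
exists (re s t); split; first by rewrite -(emb_gt0 s) -emb_re// ltW.
rewrite embV -emb_re ?ltW//; apply/scale_setP; last exact: H.
by rewrite gt_eqF.
Qed.

Lemma gauge_ge0 y : S y -> 0 <= gauge y.
Proof. by move=> Sy; apply: lb_le_inf; [exact: gauge_ne|exact: gauge_lb]. Qed.

Lemma gauge_le y t : 0 < t -> G (emb t^-1 *: y) -> gauge y <= t.
Proof. by move=> t0 Gy; apply: ge_inf; [exists 0; exact: gauge_lb|]. Qed.

Lemma gauge_lt y t : S y -> gauge y < t -> G (emb t^-1 *: y).
Proof.
move=> Sy yt; have [u [u0 Gu] ut] : exists2 u, 0 < u /\ G (emb u^-1 *: y) & u < t.
  by apply: inf_lt; [exact: gauge_ne|].
have t0 : 0 < t by exact: lt_trans ut.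
have -> : emb t^-1 *: y = emb (u / t) *: (emb u^-1 *: y).
  by rewrite scalerA -embM mulrAC divff ?mul1r ?gt_eqF.
apply: ac_scale => //; rewrite (nm_le1 s) nm_emb gtr0_norm ?divr_gt0//.
by rewrite ler_pdivrMr// mul1r ltW.
Qed.

Lemma gaugeZ z y : S y -> gauge (z *: y) <= nm z * gauge y.
Proof.
move=> Sy; apply/ler_addgt0Pr => e e0.
pose e' := e / (nm z + 1); have z1 : 0 < nm z + 1 by rewrite ltr_wpDl// nm_ge0.
have e'0 : 0 < e' by rewrite divr_gt0.
have g0 := gauge_ge0 Sy.
pose T := nm z * gauge y + e.
have T0 : 0 < T by rewrite ltr_wpDl// mulr_ge0// nm_ge0.
have gy : gauge y < gauge y + e' by rewrite ltrDl.
have ge0 : 0 < gauge y + e' by rewrite ltr_wpDl.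
apply: gauge_le => //.
have -> : emb T^-1 *: (z *: y) =
    (z * emb ((gauge y + e') / T)) *: (emb (gauge y + e')^-1 *: y).
  rewrite !scalerA -mulrA -embM mulrAC divff ?gt_eqF// mul1r mulrC//.
apply: ac_scale; [exact: cG| |exact: gauge_lt].
rewrite (nm_le1 s) nmM nm_emb gtr0_norm ?divr_gt0// mulrA ler_pdivrMr// mul1r /T mulrDr lerD2l.
by rewrite /e' mulrCA ger_pMr// ler_pdivrMr// mul1r lerDl.
Qed.

Lemma gaugeD y z : S y -> S z -> gauge (y + z) <= gauge y + gauge z.
Proof.
move=> Sy Sz; apply/ler_addgt0Pr => e e0.
pose t1 := gauge y + e / 2; pose t2 := gauge z + e / 2.
have t10 : 0 < t1 by rewrite ltr_wpDl ?gauge_ge0// divr_gt0.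
have t20 : 0 < t2 by rewrite ltr_wpDl ?gauge_ge0// divr_gt0.
have -> : gauge y + gauge z + e = t1 + t2 by rewrite /t1 /t2; field.
have T0 : 0 < t1 + t2 by exact: addr_gt0.
have h1 : G (emb t1^-1 *: y) by apply: gauge_lt => //; rewrite ltrDl divr_gt0.
have h2 : G (emb t2^-1 *: z) by apply: gauge_lt => //; rewrite ltrDl divr_gt0.
apply: gauge_le => //; rewrite embV; apply/scale_setP; first by rewrite emb_eq0 gt_eqF.
rewrite -[y]scale1r -[z]scale1r.
apply: (@ac_comb _ _ _ _ _ (emb t1) (emb t2)); rewrite ?emb_ge0 ?emb_gt0 ?(ltW t10) ?(ltW t20)//.
- by apply/scale_setP; [rewrite emb_eq0 gt_eqF|rewrite -embV].
- by apply/scale_setP; [rewrite emb_eq0 gt_eqF|rewrite -embV].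
- by rewrite normr1 !mul1r (embD s t1 t2).
Qed.

Lemma gauge_sublinear : sublinear gauge.
Proof.
split; first exact: gaugeD.
by move=> a x a0 Sx; apply: le_trans (gaugeZ _ Sx) _; rewrite nm_emb gtr0_norm.
Qed.

Lemma gauge_le1 y : G y -> gauge y <= 1.
Proof. by move=> Gy; apply: gauge_le => //; rewrite invr1 emb1 scale1r. Qed.

(** The real theorem for the gauge yields the real part of [u]. Rotating [u y] to a nonnegative real
    extends the bound to the modulus, since the gauge is invariant under unimodular factors. *)
Lemma hahn_banach x : S x -> exists u : V -> K^o,
  [/\ linear_on S u, forall y, S y -> nm (u y) <= gauge y & gauge x <= nm (u x)].
Proof.
move=> Sx; have [r [rD rZ rp rx]] := hahn_banach_real gauge_sublinear Sx.
have [u [lu ur]] := linear_of_re HS rD rZ; exists u; split=> // [y Sy|]; last first.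
  by apply: le_trans rx _; rewrite -ur; apply: le_trans (re_nm s _); exact: ler_norm.
have [w w1 wu] := nm_rotate s (u y).
rewrite -[nm (u y)](re_emb s) -wu -[w * _](linear_onZ HS lu)// ur.
by apply: le_trans (rp _ (subspaceZ HS _ Sy)) _; apply: le_trans (gaugeZ _ Sy) _; rewrite w1 mul1r.
Qed.

End Gauge.
End HahnBanach.

(** * Strong duals *)

(** The index type is arbitrary so that one statement covers prepolars of sets of functionals,
    polars of sets of points, and, with index [unit], a single functional. *)
Lemma linear_ball_ac (R : realType) (K : numFieldType) (s : scalars R K)
    (V : lmodType K) (S : set V) (I : Type) (P : set I) (u : I -> V -> K^o) (e : R) :
  subspace S -> 0 <= e -> (forall i, P i -> linear_on S (u i)) ->
  absconvex [set x | S x /\ forall i, P i -> knorm s (u i x) <= e].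
Proof.
move=> HS e0 lu a c x y [Sx Hx] [Sy Hy] ac.
have Sax := subspaceZ HS a Sx; have Scy := subspaceZ HS c Sy.
split; first exact: (subspaceD HS).
move=> i Pi; rewrite (linear_onD (lu _ Pi))// !(linear_onZ HS (lu _ Pi))//.
apply: le_trans (nmD s (a * u i x) (c * u i y)) _; rewrite !nmM.
have : knorm s a + knorm s c <= 1 by rewrite -(emb_le s) embD -!nmE emb1.
have := Hx _ Pi; have := Hy _ Pi; have := nm_ge0 s a; have := nm_ge0 s c; nra.
Qed.

Section Dual.
Variables (R : realType) (K : numFieldType) (s : scalars R K).
Variables (V : lmodType K) (S : set V) (N : set (set V)).
Hypothesis HN : lcH S N.
Implicit Types (f g : V -> K^o) (B : set V).
Local Notation emb := (emb s).
Local Notation nm := (knorm s).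
Local Notation HS := (lc_subspace HN).

(** [dual] normalises functionals to vanish outside [S]; this brings a functional given on [S] into
    that form. *)
Definition restr (u : V -> K^o) : V -> K^o := fun x => if `[< S x >] then u x else 0.

Lemma restrE (u : V -> K^o) x : S x -> restr u x = u x.
Proof. by move=> Sx; rewrite /restr asboolT. Qed.

Lemma restr_out (u : V -> K^o) x : ~ S x -> restr u x = 0.
Proof. by move=> Sx; rewrite /restr asboolF. Qed.

Lemma restr_linear (u : V -> K^o) : linear_on S u -> linear_on S (restr u).
Proof.
move=> lu a x y Sx Sy; rewrite !restrE ?lu//.
by case: HS => _; apply.
Qed.

Lemma restr_dual (u : V -> K^o) : linear_on S u ->
  nbhd0 N [set x | nm (u x) <= 1] -> dual S N (restr u).
Proof.
move=> lu [U [NU HU]]; split; first exact: restr_linear.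
  exact: restr_out.
exists U; split=> // x Ux; rewrite restrE ?(nm_le1 s)//; last exact: (lc_sub HN) Ux.
exact: HU.
Qed.

Lemma dual_linear f : dual S N f -> linear_on S f.
Proof. by case. Qed.

Lemma dual_ext f g : dual S N f -> dual S N g -> (forall x, S x -> f x = g x) -> f = g.
Proof.
move=> [_ f0 _] [_ g0 _] fg; apply/funext => x.
by have [/fg//|nS] := pselect (S x); rewrite f0 ?g0.
Qed.

Lemma dual_small f e : dual S N f -> 0 < e ->
  exists U, N U /\ forall x, U x -> nm (f x) <= e.
Proof.
move=> df e0; have lf := dual_linear df; have [_ _ [U [NU HU]]] := df.
have e0' : 0 <= emb e^-1 by rewrite emb_ge0 invr_ge0 ltW.
have [n Hn] := scalar_bound s e0'.
have [W [NW HW]] := lc_nat HN n NU; exists W; split=> // x Wx.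
have := HU _ (HW _ Wx); rewrite (linear_onZ HS lf); last exact: (lc_sub HN) Wx.
rewrite (nm_le1 s) nmM -(emb_nat s) nm_emb normr_nat => h.
have e1 : e^-1 <= n%:R by rewrite -(emb_le s) emb_nat.
have : e^-1 * nm (f x) <= 1 by apply: le_trans h; rewrite ler_wpM2r ?nm_ge0.
by rewrite ler_pdivrMl// mulr1.
Qed.

Lemma dual_scale_bound f A (t : K) x : linear_on S f -> A `<=` S -> 0 < t ->
  (forall y, A y -> nm (f y) <= 1) -> scale_set t A x -> nm (f x) <= re s t.
Proof.
move=> lf AS t0 fA [y Ay <-]; rewrite (linear_onZ HS lf); last exact: AS.
have -> : re s t = nm t by rewrite /knorm gtr0_norm.
by rewrite nmM -[leRHS]mulr1 ler_wpM2l ?nm_ge0// fA.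
Qed.

Lemma dual_bounded f B : dual S N f -> bounded S N B ->
  exists2 M, 0 < M & forall x, B x -> nm (f x) <= M.
Proof.
move=> df [BS HB]; have [U [NU HU]] := dual_small df ltr01.
have /absorbsE [t [t0 Ht]] := HB _ NU; exists (re s t).
  by rewrite -(emb_gt0 s) -emb_re// ltW.
move=> x /Ht; apply: dual_scale_bound => //; [exact: dual_linear|exact: (lc_sub HN)].
Qed.

Lemma subspace_dual : subspace (dual S N).
Proof.
split.
  have [U NU] : exists U, N U by case: HN => -[].
  split=> //; first by move=> a x y _ _; rewrite scaler0 addr0.
  by exists U; split=> // x _; rewrite normr0.
move=> a f g df dg; have lf := dual_linear df; have lg := dual_linear dg.
have [_ f0 _] := df; have [_ g0 _] := dg.
have fgE x : (a *: f + g) x = a * f x + g x by [].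
split.
- move=> c x y Sx Sy; rewrite !fgE lf// lg// /GRing.scale /=; ring.
- by move=> x nS; rewrite fgE f0// g0// mulr0 addr0.
- have e0 : 0 < 2^-1 / (nm a + 1) by rewrite divr_gt0 ?invr_gt0// ltr_wpDl// nm_ge0.
  have h0 : 0 < 2^-1 :> R by rewrite invr_gt0.
  have [U [NU HU]] := dual_small df e0; have [W [NW HW]] := dual_small dg h0.
  have [U' [NU' HU']] := lc_inter HN NU NW.
  exists U'; split=> // x /HU' [/HU hf /HW hg]; rewrite (nm_le1 s) fgE.
  apply: le_trans (nmD _ _ _) _; rewrite nmM.
  have a1 : 0 < nm a + 1 by rewrite ltr_wpDl// nm_ge0.
  move: hf; rewrite ler_pdivlMr// => hf.
  have := nm_ge0 s (f x); have := nm_ge0 s a; nra.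
Qed.

Lemma polarP B f : dual S N f -> polar S N B f <-> forall x, B x -> nm (f x) <= 1.
Proof.
by move=> df; split=> [[_ H] x /H|H]; [rewrite (nm_le1 s)|split=> // x /H; rewrite (nm_le1 s)].
Qed.

Lemma polar_sub B B' : B `<=` B' -> polar S N B' `<=` polar S N B.
Proof. by move=> BB f [df H]; split=> // x /BB; exact: H. Qed.

Lemma polar_ac B : absconvex (polar S N B).
Proof.
move=> a c f g [df Hf] [dg Hg] ac; split; last first.
  move=> x Bx; apply: le_trans (ler_normD _ _) _; apply: le_trans ac.
  rewrite /GRing.scale /= !normrM; apply: lerD; rewrite -[leRHS]mulr1 ler_wpM2l//.
    exact: Hf.
  exact: Hg.
by apply: (subspaceD subspace_dual); exact: (subspaceZ subspace_dual).
Qed.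

Lemma polar_scale B f M : dual S N f -> 0 < M -> (forall x, B x -> nm (f x) <= M) ->
  scale_set (emb M) (polar S N B) f.
Proof.
move=> df M0 H; apply/scale_setP; first by rewrite emb_eq0 gt_eqF.
apply/polarP; first exact: (subspaceZ subspace_dual).
move=> x /H fM; have -> : ((emb M)^-1 *: f) x = (emb M)^-1 * f x by [].
by rewrite nmM -embV nm_emb gtr0_norm ?invr_gt0// ler_pdivrMl// mulr1.
Qed.

Lemma polar_scaleE B f (t : K) x : 0 < t -> scale_set t (polar S N B) f -> B x ->
  nm (f x) <= re s t.
Proof.
move=> t0 [g [_ Hg] <-] /Hg; rewrite (nm_le1 s) => h.
have -> : re s t = nm t by rewrite /knorm gtr0_norm.
by rewrite (_ : (t *: g) x = t * g x)// nmM -[leRHS]mulr1 ler_wpM2l ?nm_ge0.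
Qed.

Lemma strong_boundedP (D : set (V -> K^o)) : bounded (dual S N) (strong_base S N) D <->
  D `<=` dual S N /\ forall B, bounded S N B ->
    exists2 M, 0 < M & forall f x, D f -> B x -> nm (f x) <= M.
Proof.
split=> [[DS HD]|[DS HD]]; split=> //.
  move=> B bB; have /absorbsE [t [t0 Ht]] : absorbs (polar S N B) D.
    by apply: HD; exists B.
  exists (re s t); first by rewrite -(emb_gt0 s) -emb_re// ltW.
  by move=> f x /Ht; exact: polar_scaleE.
move=> _ [B [bB ->]]; have [M M0 HM] := HD _ bB.
apply: (absorbsW (t := emb M)); [exact: polar_ac|by rewrite emb_gt0|].
by move=> f Df; apply: polar_scale => //; [exact: DS|move=> x; exact: HM].
Qed.

Lemma strong_lcH : lcH (dual S N) (strong_base S N).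
Proof.
split.
- split; first exact: subspace_dual.
  by exists (polar S N [set 0]); exists [set 0]; split=> //; apply: (bounded1 HN); exact: (subspace0 HS).
- move=> _ [B [bB ->]]; split; [by move=> f []|exact: polar_ac|].
  move=> f df; have [M M0 HM] := dual_bounded df bB.
  apply: (absorbsW (t := emb M)); [exact: polar_ac|by rewrite emb_gt0|].
  by move=> _ ->; exact: polar_scale.
- move=> _ _ [B [bB ->]] [B' [bB' ->]]; exists (polar S N (B `|` B')); split.
    by exists (B `|` B'); split=> //; exact: (boundedU HN).
  by move=> f Hf; split; apply: polar_sub Hf => x; [left|right].
- move=> _ [B [bB ->]]; exists (polar S N (scale_set 2 B)); split.
    by exists (scale_set 2 B); split=> //; exact: (bounded_scale HN).
  move=> _ [f [df Hf] <-]; split; first exact: (subspaceZ subspace_dual).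
  move=> x Bx; have := Hf (2 *: x); rewrite (linear_onZ HS (dual_linear df)).
    by apply; exists x.
  by case: bB => BS _; exact: BS.
- move=> f df /eqP f0; have [x [Sx fx]] : exists x, S x /\ f x != 0.
    apply: contrapT => H; apply: f0; apply: (dual_ext df subspace_dual.1) => x Sx.
    by apply/eqP; apply: contrapT => /negP fx; apply: H; exists x.
  (* At this multiple of [x] the functional takes the value 2, so [f] violates the polar
     condition. *)
  exists (polar S N [set (2 / f x) *: x]); split.
    by exists [set (2 / f x) *: x]; split=> //; apply: (bounded1 HN); exact: (subspaceZ HS).
  move=> [_ /(_ _ erefl)]; rewrite (linear_onZ HS (dual_linear df))// /GRing.scale /= divfK//.
  by rewrite normr_nat (ler_nat _ 2 1).
Qed.

Lemma dual_norming U x : N U -> S x -> exists f,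
  [/\ dual S N f, forall y, S y -> nm (f y) <= gauge s U y & gauge s U x <= nm (f x)].
Proof.
move=> NU Sx.
have [u [lu ub ux]] := hahn_banach s HS (lc_ac HN NU) (lc_absorbing HN NU) Sx.
exists (restr u); split; last by rewrite restrE.
  apply: restr_dual => //; exists U; split=> // y Uy /=.
  by apply: le_trans (ub _ _) _; [exact: (lc_sub HN) Uy|exact: gauge_le1].
by move=> y Sy; rewrite restrE //; exact: ub.
Qed.

(** This is the nontrivial half of the bipolar theorem. Thickening [A] by a neighbourhood [U] that
    keeps it away from [x] gives an absorbing set whose gauge at [x] is at least 1, and Hahn-Banach
    applies to that gauge. *)
Lemma separation A x : absconvex A -> is_closed S N A -> A 0 -> S x -> ~ A x ->
  exists f, [/\ dual S N f, forall y, A y -> nm (f y) <= 1 & 1 < nm (f x)].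
Proof.
move=> cA [AS clA] A0 Sx nAx; have [U [NU /seteqP [HU _]]] := clA _ Sx nAx.
have cU := lc_ac HN NU; have US := lc_sub HN NU.
pose G := [set z | exists y u, [/\ A y, U u & z = y + u]].
have GS : G `<=` S.
  by move=> _ [y [u [Ay Uu ->]]]; apply: (subspaceD HS); [exact: AS|exact: US].
have cG : absconvex G.
  move=> a c _ _ [y [u [Ay Uu ->]]] [y' [u' [Ay' Uu' ->]]] ac.
  exists (a *: y + c *: y'), (a *: u + c *: u'); split; [exact: cA|exact: cU|].
  by rewrite !scalerDr addrACA.
have UG : U `<=` G by move=> u Uu; exists 0, u; rewrite add0r.
have aG : absorbing S G.
  by move=> y /(lc_absorbing HN NU); apply: absorbsS.
have nGx : ~ G x.
  move=> [y [u [Ay Uu xE]]]; apply: (HU y); split=> //; apply/translateP.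
  by rewrite xE opprD addrA subrr add0r; apply: acN.
have [u [lu ub ux]] := hahn_banach s HS cG aG Sx.
have g1 : 1 <= gauge s G x.
  rewrite leNgt; apply/negP => g1; apply: nGx.
  by have := gauge_lt cG aG Sx g1; rewrite invr1 emb1 scale1r.
have uG z : G z -> nm (u z) <= 1.
  by move=> Gz; apply: le_trans (ub _ (GS _ Gz)) _; exact: gauge_le1.
(* Strict separation comes from the summand [U]: a multiple [v] of [x] lies in [U] and [u v] is
   nonzero. After rotating both terms, [nm (u y) + nm (u v) <= 1] for [y] in [A], and this gap
   allows rescaling [u]. *)
have [e [e0 e1 Ae]] : exists e, [/\ 0 < e, e < 1 & forall y, A y -> nm (u y) <= 1 - e].
  have /absorbsE [t [t0 Ht]] := lc_absorbing HN NU Sx.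
  have [v Uv xv] := Ht _ erefl.
  have uv0 : 0 < nm (u v).
    rewrite lt_neqAle nm_ge0 andbT eq_sym nm_eq0; apply/eqP => uv.
    move: (le_trans g1 ux); rewrite -xv (linear_onZ HS lu); last exact: US.
    by rewrite uv scaler0 nm0 ler10.
  have Ae y : A y -> nm (u y) <= 1 - nm (u v).
    move=> Ay; have [w w1 wy] := nm_rotate s (u y); have [w' w'1 wv] := nm_rotate s (u v).
    have Sy := AS _ Ay; have Sv := US _ Uv.
    have : nm (u (w *: y + w' *: v)) <= 1.
      apply: uG; exists (w *: y), (w' *: v); split=> //; apply: ac_scale => //.
        by rewrite (nm_le1 s) w1.
      by rewrite (nm_le1 s) w'1.
    rewrite (linear_onD lu) ?(linear_onZ HS lu)//; [|exact: (subspaceZ HS)..].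
    rewrite /GRing.scale /= wy wv -embD nm_emb ger0_norm ?addr_ge0 ?nm_ge0//.
    by rewrite lerBrDr.
  (* Half of the gap is used because [nm (u v)] may equal 1, while the division by [1 - e] needs
     [e < 1]. *)
  exists (nm (u v) / 2); split; first by rewrite divr_gt0.
    have := Ae _ A0; have := nm_ge0 s (u 0); lra.
  by move=> y /Ae; lra.
have e1' : 0 < 1 - e by rewrite subr_gt0.
pose f := restr (fun y => emb (1 - e)^-1 *: u y).
have lf : linear_on S (fun y => emb (1 - e)^-1 *: u y).
  by move=> a y z Sy Sz; rewrite lu// /GRing.scale /=; ring.
have nf y : S y -> nm (f y) = nm (u y) / (1 - e).
  by move=> Sy; rewrite /f restrE// nmM nm_emb gtr0_norm ?invr_gt0// mulrC.
have [U' [NU' HU']] : exists U', N U' /\ forall y, U' y -> nm (u y) <= 1 - e.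
  have du : dual S N (restr u).
    by apply: restr_dual => //; exists U; split=> // y /UG; exact: uG.
  have [U' [NU' HU']] := dual_small du e1'; exists U'; split=> // y Uy.
  by have := HU' _ Uy; rewrite restrE//; exact: (lc_sub HN) Uy.
exists f; split.
- apply: restr_dual => //; exists U'; split=> // y /[dup] Uy /HU' h /=.
  have Sy := lc_sub HN NU' Uy; have := nf _ Sy; rewrite /f restrE// => ->.
  by rewrite ler_pdivrMr// mul1r.
- by move=> y Ay; rewrite nf; [rewrite ler_pdivrMr// mul1r Ae|exact: AS].
- by rewrite nf// ltr_pdivlMr// mul1r; lra.
Qed.

End Dual.

Section FunctionalLimits.
Variables (R : realType) (K : numFieldType) (s : scalars R K).
Variables (V : lmodType K) (S : set V).
Hypothesis HS : subspace S.
Local Notation emb := (emb s).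
Local Notation nm := (knorm s).

(** This takes the place of Tychonoff's theorem in the gliding hump, in the completeness of strong
    duals and in Alaoglu's theorem. Continuity of the limit is established separately in each
    case. *)
Lemma functional_ultra_lim (T : Type) (G : set_system T) (UG : UltraFilter G)
    (u : T -> V -> K^o) :
  G [set t | linear_on S (u t)] ->
  (forall x, S x -> exists M, G [set t | nm (u t x) <= M]) ->
  exists l : V -> K^o, [/\ linear_on S l, forall x, ~ S x -> l x = 0 &
    forall x, S x -> forall e, 0 < e -> G [set t | nm (u t x - l x) <= e]].
Proof.
move=> Glin Gb.
have /choice [l Hl] : forall x, exists y : K^o, S x ->
    forall e, 0 < e -> G [set t | nm (u t x - y) <= e].
  move=> x; have [Sx|nS] := pselect (S x); last by exists 0.
  by have [M GM] := Gb _ Sx; have [y Hy] := ultra_lim UG GM; exists y.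
exists (restr S l); split; [|exact: restr_out|by move=> x Sx; rewrite restrE//; exact: Hl].
move=> a x y Sx Sy.
have Sxy : S (a *: x + y) by case: HS => _; apply.
rewrite !restrE//.
apply/eqP; rewrite -subr_eq0 -(nm_eq0 s) eq_le nm_ge0 andbT.
apply/ler_addgt0Pr => e e0; rewrite add0r.
have a1 : 0 < nm a + 1 by rewrite ltr_wpDl// nm_ge0.
have d0 : 0 < e / (nm a + 1) by rewrite divr_gt0.
apply: (ultra_lim_le UG (Hl _ Sxy)).
apply: filterS (filterI Glin (filterI (Hl _ Sx _ d0) (Hl _ Sy _ d0))) => t [/= lt [h1 h2]].
rewrite lt// (_ : _ - _ = a * (u t x - l x) + (u t y - l y)); last by rewrite /GRing.scale /=; ring.
apply: le_trans (nmD _ _ _) _; rewrite nmM.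
apply: (@le_trans _ _ ((nm a + 1) * (e / (nm a + 1)))); last by rewrite mulrC divfK ?gt_eqF.
by rewrite mulrDl mul1r lerD// ler_wpM2l// nm_ge0.
Qed.

End FunctionalLimits.

(** * Mackey's theorem on bounded sets *)

Section DualTheorems.
Variables (R : realType) (K : numFieldType) (s : scalars R K).
Variables (V : lmodType K) (S : set V) (N : set (set V)).
Hypothesis HN : lcH S N.
Implicit Types (f g : V -> K^o) (B C U W : set V).
Local Notation emb := (emb s).
Local Notation nm := (knorm s).
Local Notation HS := (lc_subspace HN).

(* Mackey's theorem by the gliding hump: if the gauge of [U] is unbounded on [B]
   along [xs k], then [sum_k eps_k 4^-k f_k] with [f_k] norming at [xs k] and
   [eps_k] in {0, 1} chosen greedily is a continuous functional unbounded on [B].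
   The series converges pointwise along any free ultrafilter. *)
Lemma weakly_bounded B : B `<=` S ->
  (forall f, dual S N f -> exists M, forall x, B x -> nm (f x) <= M) ->
  bounded S N B.
Proof.
move=> BS wb; split=> // U NU; apply: contrapT => nabs.
have cU := lc_ac HN NU; have aU := lc_absorbing HN NU.
pose p := gauge s U.
have pge0 x : S x -> 0 <= p x by move=> Sx; exact: (gauge_ge0 s aU).
have big M : 0 < M -> exists x, B x /\ M <= p x.
  move=> M0; apply: contrapT => H; apply: nabs.
  apply: (absorbsW (t := emb M)); [exact: cU|by rewrite emb_gt0|].
  move=> x Bx; apply/scale_setP; first by rewrite emb_eq0 gt_eqF.
  rewrite -embV; apply: (gauge_lt cU aU); first exact: BS.
  by rewrite ltNge; apply/negP => Mp; apply: H; exists x.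
pose c k : R := 4^-1 ^+ k.
have c0 k : 0 < c k by rewrite exprn_gt0// invr_gt0.
have cS k : c k.+1 = c k / 4 by rewrite /c exprSr.
(* The hump at [xs k] is at least [c k / 2] times the gauge and the tail after it at most [c k / 3]
   times, which leaves [c k / 6]. The factor 6 therefore makes the limit at least [k + 1] at
   [xs k]. *)
have /choice [xs Hxs] : forall k, exists x, B x /\ 6 * k.+1%:R / c k <= p x.
  by move=> k; apply: big; rewrite divr_gt0// mulr_gt0.
have Sxs k : S (xs k) by apply: BS; exact: (Hxs k).1.
have /choice [fs Hfs] : forall k, exists f, [/\ dual S N f,
    forall y, S y -> nm (f y) <= p y & p (xs k) <= nm (f (xs k))].
  by move=> k; exact: dual_norming.
(* If the current value at [xs k] is below half the hump, adding the full hump leaves more than half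
   of it. *)
pose next k f : V -> K^o :=
  if c k / 2 * p (xs k) <= nm (f (xs k)) then f else f + emb (c k) *: fs k.
pose u := fix u n : V -> K^o := if n is k.+1 then next k (u k) else 0.
have du k : dual S N (u k).
  elim: k => [|k IH]; first exact: (subspace_dual s HN).1.
  rewrite /= /next; case: ifP => // _; apply: (subspaceD (subspace_dual s HN)) => //.
  by apply: (subspaceZ (subspace_dual s HN)); have [] := Hfs k.
have ustep k y : S y -> nm (u k.+1 y - u k y) <= c k * p y.
  move=> Sy; rewrite /= /next; case: ifP => _.
    by rewrite subrr nm0 mulr_ge0 ?pge0// ltW.
  rewrite (_ : (u k + _) y = u k y + emb (c k) * fs k y)// addrAC subrr add0r.
  rewrite nmM nm_emb gtr0_norm// ler_wpM2l ?(ltW (c0 k))//.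
  by have [_ + _] := Hfs k; apply.
have uhump k : c k / 2 * p (xs k) <= nm (u k.+1 (xs k)).
  rewrite /= /next; case: ifPn => //; rewrite -ltNge => h.
  rewrite (_ : (u k + _) _ = u k (xs k) + emb (c k) * fs k (xs k))//.
  have [_ _ h2] := Hfs k.
  have := nmB s (u k (xs k) + emb (c k) * fs k (xs k)) (u k (xs k)).
  rewrite addrAC subrr add0r nmM nm_emb gtr0_norm// => h3.
  have := ler_wpM2l (ltW (c0 k)) h2; lra.
(* The constant [4 / 3] is the sum of the geometric series of ratio [1 / 4]. *)
have utail n k y : S y -> nm (u (k + n)%N y - u k y) <= 4 / 3 * c k * p y.
  move=> Sy; elim: n k => [|n IH] k.
    by rewrite addn0 subrr nm0 mulr_ge0 ?pge0// mulr_ge0 ?(ltW (c0 k))// divr_ge0.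
  rewrite addnS -addSn.
  rewrite (_ : _ - _ = (u (k.+1 + n)%N y - u k.+1 y) + (u k.+1 y - u k y)); last by ring.
  apply: le_trans (nmD _ _ _) _.
  have := IH k.+1; have := ustep k _ Sy; rewrite cS => h1 h2.
  have := mulr_ge0 (ltW (c0 k)) (pge0 _ Sy); lra.
have [G [UG FG]] := ultraFilterLemma eventually_filter.
have Gtail k y : S y -> G [set n | nm (u n y - u k y) <= 4 / 3 * c k * p y].
  move=> Sy; apply: FG; exists k => // n /= kn.
  by rewrite -(subnKC kn); exact: utail.
have [|y Sy|l [ll l0 Hl]] := functional_ultra_lim (s := s) HS UG (u := u).
- by apply: filterS filterT => n _; exact: dual_linear.
- exists (4 / 3 * c 0%N * p y); apply: filterS (Gtail 0%N y Sy) => n /=.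
  by rewrite subr0.
have ltail k y : S y -> nm (l y - u k y) <= 4 / 3 * c k * p y.
  by move=> Sy; apply: (ultra_lim_le UG (Hl _ Sy)); exact: Gtail.
have dl : dual S N l.
  (* On [U] the limit is bounded only by [4 / 3]; passing to a half-size neighbourhood brings this
     to [2 / 3]. *)
  split=> //; have [W [NW HW]] := lc_half HN NU; exists W; split=> // y Wy.
  have Sy := lc_sub HN NW Wy; rewrite (nm_le1 s).
  have := ltail 0%N _ (subspaceD HS Sy Sy).
  rewrite subr0 (linear_onD ll)// (_ : l y + l y = emb 2%:R * l y).
    2: by rewrite emb_nat mulr_natl mulr2n.
  rewrite nmM nm_emb normr_nat.
  have := gauge_le1 s (HW _ _ Wy Wy); rewrite /c expr0 -/(p _) => h1 h2; lra.
have [M HM] := wb _ dl.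
have [k Mk] : exists k : nat, M <= k%:R.
  exists (Num.bound `|M|); apply: le_trans (ler_norm _) _.
  by apply/ltW/archi_boundP.
have [Bx px] := Hxs k; have := HM _ Bx; have := ltail k.+1 _ (Sxs k); have := uhump k.
move: px; rewrite ler_pdivrMr// cS -natr1.
have := nmB s (l (xs k)) (l (xs k) - u k.+1 (xs k)).
rewrite opprB addrC subrK; nra.
Qed.

End DualTheorems.

(** * Semi-reflexivity, and barrelledness and completeness of strong duals *)

Section SemiReflexive.
Variables (R : realType) (K : numFieldType) (s : scalars R K).
Variables (V : lmodType K) (S : set V) (N : set (set V)).
Hypothesis HN : lcH S N.
Implicit Types (f g : V -> K^o) (B C U W : set V).
Local Notation emb := (emb s).
Local Notation nm := (knorm s).
Local Notation re := (re s).
Local Notation cj := (cj s).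
Local Notation HS := (lc_subspace HN).
Local Notation HD := (subspace_dual s HN).

Lemma dual_converges f (G : set_system V) (UG : UltraFilter G) q e :
  dual S N f -> S q -> converges N G q -> 0 < e -> G [set x | nm (f x - f q) <= e].
Proof.
move=> df Sq cv e0; have [U [NU HU]] := dual_small s HN df e0.
apply: filterS (cv _ NU) => x /translateP xU.
have Sx : S x.
  by rewrite -[x](subrK q); apply: (subspaceD HS) => //; exact: (lc_sub HN) xU.
by rewrite /= -(linear_onB HS (dual_linear df))//; exact: HU.
Qed.

Lemma dual_sum (fs : seq (V -> K^o)) (c : (V -> K^o) -> K) (Phi : (V -> K^o) -> K^o) :
  linear_on (dual S N) Phi -> {in fs, forall f, dual S N f} ->
  exists g, [/\ dual S N g, forall x, g x = \sum_(f <- fs) c f * f x &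
    Phi g = \sum_(f <- fs) c f * Phi f].
Proof.
move=> lPhi; elim: fs => [|f fs IH] Hfs.
  exists 0; split; [exact: HD.1|by move=> x; rewrite big_nil|].
  by rewrite big_nil (linear_on0 HD lPhi).
have [h|g [dg gE Pg]] := IH; first by move=> hfs; apply: Hfs; rewrite in_cons hfs orbT.
have df : dual S N f by apply: Hfs; rewrite mem_head.
exists (c f *: f + g); split; first by case: HD => _; apply.
- by move=> x; rewrite big_cons -gE.
- by rewrite big_cons -Pg lPhi.
Qed.

(** The error is proportional to [b'], the residual at the fixed limit point, so the total error is
    controlled independently of the approximating point [x]. *)
Lemma sqr_near (a b' e : R) : 0 <= a -> 0 <= b' -> 0 <= e -> b' <= a + e ->
  b' ^+ 2 <= a ^+ 2 + 2 * e * b'.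
Proof.
move=> a0 b0 e0 h; have [be|eb] := leP b' e.
  by have := sqr_ge0 a; have := mulr_ge0 e0 b0; nra.
by have : (b' - e) ^+ 2 <= a ^+ 2; [rewrite ler_sqr ?nnegrE//; lra|have := sqr_ge0 e; nra].
Qed.

(* The point of [C] minimising [sum_f |Phi f - f x|^2] interpolates exactly: its
   first-order condition bounds [g = sum_f conj(r_f) f], [r_f] the residuals, on [C] by
   [Re (g q)], and then [|Phi g| <= Re (g q)] reads [sum_f |r_f|^2 <= 0]. *)
Lemma interpolation (Phi : (V -> K^o) -> K^o) C (fs : seq (V -> K^o)) :
  linear_on (dual S N) Phi -> absconvex C -> is_compact S N C -> C 0 ->
  (forall f, dual S N f -> (forall x, C x -> nm (f x) <= 1) -> nm (Phi f) <= 1) ->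
  {in fs, forall f, dual S N f} ->
  exists2 q, C q & {in fs, forall f, f q = Phi f}.
Proof.
move=> lPhi cC kC C0 PhiC Hfs.
have CS : C `<=` S by case: kC.
pose h x : R := \sum_(f <- fs) nm (Phi f - f x) ^+ 2.
have h0 x : 0 <= h x by apply: sumr_ge0 => f _; exact: sqr_ge0.
pose E := [set h x | x in C]; pose m := inf E.
have lE : has_lbound E by exists 0 => _ [x _ <-].
have mle x : C x -> m <= h x by move=> Cx; apply: ge_inf => //; exists x.
(* The near-minimisers in [C] form a filter base; a finer ultrafilter converges in [C], and
   continuity of the finitely many functionals passes the infimum to its limit. *)
have [q Cq hq] : exists2 q, C q & h q <= m.
  pose B e := [set x | C x /\ h x <= m + e].
  have FF : Filter (filter_from [set e : R | 0 < e] B).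
    apply: filter_from_filter; first by exists 1 => /=.
    move=> e e' /= e0 e'0; exists (Num.min e e'); first by rewrite /= lt_min e0.
    by move=> x [Cx hx]; split; split=> //; apply: le_trans hx _; rewrite lerD2l ge_min lexx ?orbT.
  have PF : ProperFilter (filter_from [set e : R | 0 < e] B).
    apply: filter_from_proper => e /= e0.
    have [_ [x Cx <-] xe] : exists2 y, E y & y < m + e.
      by apply: inf_adherent => //; split=> //; exists (h 0); exists 0.
    by exists x; split=> //; exact: ltW.
  have [G [UG FG]] := ultraFilterLemma PF.
  have GC : G C by apply: FG; exists 1 => //= x [].
  have [q Cq cvq] := compact_ultra HN kC UG GC; exists q => //.
  have Gall e : 0 < e -> G [set x | {in fs, forall f, nm (f x - f q) <= e}].
    move=> e0; elim: fs Hfs {h h0 E m lE mle B FF PF FG} => [|f fs' IH] Hfs.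
      by apply: filterS filterT => x _ f; rewrite in_nil.
    have Gf : G [set x | nm (f x - f q) <= e].
      by apply: dual_converges => //; [apply: Hfs; rewrite mem_head|exact: CS].
    have Gfs : G [set x | {in fs', forall f, nm (f x - f q) <= e}].
      by apply: IH => g gfs; apply: Hfs; rewrite in_cons gfs orbT.
    apply: filterS (filterI Gf Gfs) => x [/= h1 h2] g.
    by rewrite in_cons => /orP[/eqP ->//|]; exact: h2.
  pose L := \sum_(f <- fs) nm (Phi f - f q).
  have L0 : 0 <= L by apply: sumr_ge0 => f _; exact: nm_ge0.
  apply/ler_addgt0Pr => e e0.
  have L1 : 0 < 1 + 2 * L by lra.
  have d0 : 0 < e / (1 + 2 * L) by rewrite divr_gt0.
  have GB : G (B (e / (1 + 2 * L))) by apply: FG; exists (e / (1 + 2 * L)).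
  have [x [[Cx hx] /= Hx]] := filter_ex (filterI GB (Gall _ d0)).
  have dE : e / (1 + 2 * L) * (1 + 2 * L) = e by rewrite divfK ?gt_eqF.
  move: (e / _) d0 hx Hx dE => d d0 hx Hx dE.
  have : h q <= h x + 2 * d * L.
    rewrite /h /L mulr_sumr -big_split /= !big_seq; apply: ler_sum => f ffs.
    apply: sqr_near; rewrite ?nm_ge0 ?(ltW d0)//.
    rewrite (_ : Phi f - f q = (Phi f - f x) + (f x - f q)); last by ring.
    by apply: le_trans (nmD _ _ _) _; rewrite lerD2l; exact: Hx.
  by move=> h1; apply: le_trans h1 _; rewrite -dE; nra.
pose r f := Phi f - f q.
have [g [dg gE Pg]] := dual_sum (fun f => cj (r f)) lPhi Hfs.
have var d : C d -> re (g d) <= re (g q).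
  move=> Cd; rewrite -subr_le0.
  pose v f := f d - f q.
  pose A := re (g d) - re (g q); rewrite -/A.
  have AE : A = \sum_(f <- fs) re (cj (r f) * v f).
    rewrite /A -reB !gE -sumrB (big_morph re (reD s) (re0 s)).
    by apply: eq_bigr => f _; rewrite -mulrBr.
  pose Q := \sum_(f <- fs) nm (v f) ^+ 2.
  have Q0 : 0 <= Q by apply: sumr_ge0 => f _; exact: sqr_ge0.
  (* Moving from [q] towards [d] changes [h] by [- 2 * t * A + t ^+ 2 * Q], which is nonnegative by
     minimality. *)
  have step t : 0 < t -> t <= 1 -> 2 * A <= t * Q.
    move=> t0 t1; pose x := emb (1 - t) *: q + emb t *: d.
    have Cx : C x.
      apply: cC => //; rewrite !norm_emb -embD (ger0_norm (ltW t0)) ger0_norm ?subr_ge0//.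
      by rewrite subrK emb1.
    have : h x = h q - 2 * t * A + t ^+ 2 * Q.
      rewrite /h AE /Q !mulr_sumr -sumrN -!big_split /= !big_seq; apply: eq_bigr => f ffs.
      have lf := dual_linear (Hfs _ ffs).
      have -> : Phi f - f x = r f - emb t * v f.
        rewrite /x (linear_onD lf) ?(linear_onZ HS lf)//; try by [exact: CS|apply: (subspaceZ HS); exact: CS].
        by rewrite /r /v embB emb1 /GRing.scale /=; ring.
      rewrite nm_subsq nmM nm_emb (ger0_norm (ltW t0)) mulrCA re_embM /r; ring.
    have := le_trans hq (mle _ Cx) => h1 h2.
    have h3 : 2 * t * A <= t ^+ 2 * Q by rewrite h2 in h1; lra.
    by rewrite -(ler_pM2l t0); nra.
  rewrite leNgt; apply/negP => A0.
  have AQ : 0 < A + Q by rewrite ltr_pwDl.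
  (* If [A] were positive, this [t] would give [2 * A <= A * Q / (A + Q) <= A]. The denominator is
     [A + Q] because [Q] may be 0. *)
  have := step (A / (A + Q)) _ _; rewrite divr_gt0// ler_pdivrMr// mul1r lerDl Q0.
  move=> /(_ isT isT); rewrite mulrAC ler_pdivlMr//; nra.
have gM d : C d -> nm (g d) <= re (g q).
  move=> Cd; have [w w1 wg] := nm_rotate s (g d).
  rewrite -[nm _](re_emb s) -wg -[w * _](linear_onZ HS (dual_linear dg)); last exact: CS.
  by apply: var; apply: ac_scale => //; rewrite (nm_le1 s) w1.
have M0 : 0 <= re (g q) by apply: le_trans (gM _ Cq); exact: nm_ge0.
have PM : nm (Phi g) <= re (g q).
  (* The bound [re (g q)] may vanish, so [g] is normalised by a slightly larger number. *)
  apply/ler_addgt0Pr => e e0; have T0 : 0 < re (g q) + e by lra.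
  have := PhiC (emb (re (g q) + e)^-1 *: g) (subspaceZ HD _ dg).
  rewrite (linear_onZ HD lPhi)// nmM nm_emb gtr0_norm ?invr_gt0// ler_pdivrMl// mulr1.
  apply=> x Cx; rewrite (_ : (_ *: g) x = emb (re (g q) + e)^-1 * g x)//.
  rewrite nmM nm_emb gtr0_norm ?invr_gt0// ler_pdivrMl// mulr1.
  by apply: le_trans (gM _ Cx) _; lra.
have rsum : re (Phi g) = \sum_(f <- fs) nm (r f) ^+ 2 + re (g q).
  rewrite Pg gE !(big_morph re (reD s) (re0 s)) -big_split /=; apply: eq_bigr => f _.
  by rewrite nmsq !re_cj /r !reB !imB; ring.
have rs0 : \sum_(f <- fs) nm (r f) ^+ 2 <= 0.
  have := le_trans (ler_norm _) (re_nm s (Phi g)); lra.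
exists q => // f ffs; apply/esym/eqP; rewrite -subr_eq0 -(nm_eq0 s) -/(r f).
have : \sum_(f <- fs) nm (r f) ^+ 2 == 0.
  by rewrite eq_le rs0 sumr_ge0// => i _; exact: sqr_ge0.
rewrite psumr_eq0; last by move=> i _; exact: sqr_ge0.
by move=> /allP /(_ _ ffs); rewrite sqrf_eq0.
Qed.

(** Continuity of [Phi] gives a bounded [B] whose polar controls it; a compact set [C] around [B]
    controls it too. The interpolation points for finite families of functionals form a filter base
    on [C], and a limit of it represents [Phi]. *)
Lemma compact_semi_reflexive :
  (forall B, bounded S N B -> exists C, [/\ B `<=` C, absconvex C & is_compact S N C]) ->
  semi_reflexive S N.
Proof.
move=> HC Phi dPhi; have lPhi := dual_linear dPhi.
have [_ _ [_ [[B [bB ->]] PB]]] := dPhi.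
have [C [BC cC kC]] := HC _ (bounded0U HN bB).
have C0 : C 0 by apply: BC; left.
have PC f : dual S N f -> (forall x, C x -> nm (f x) <= 1) -> nm (Phi f) <= 1.
  move=> df fC; rewrite -nm_le1; apply: PB; apply/polarP => // x Bx.
  by apply: fC; apply: BC; right.
pose D := [set fs : seq (V -> K^o) | {in fs, forall f, dual S N f}].
pose E (fs : seq (V -> K^o)) := [set x | C x /\ {in fs, forall f, f x = Phi f}].
have FF : Filter (filter_from D E).
  apply: filter_from_filter; first by exists [::].
  move=> f1 f2 D1 D2; exists (f1 ++ f2).
    by move=> f; rewrite mem_cat => /orP[/D1|/D2].
  move=> x [Cx Hx]; split; split=> // f ff; apply: Hx; rewrite mem_cat ff ?orbT//.
have PF : ProperFilter (filter_from D E).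
  apply: filter_from_proper => fs Dfs.
  by have [q Cq Hq] := interpolation lPhi cC kC C0 PC Dfs; exists q.
have [G [UG FG]] := ultraFilterLemma PF.
have GC : G C by apply: FG; exists [::] => // x [].
have [q Cq cvq] := compact_ultra HN kC UG GC.
have Sq : S q by case: kC => CS _; exact: CS.
exists q; split=> // f df; apply/eqP; rewrite -subr_eq0 -(nm_eq0 s) eq_le nm_ge0 andbT.
apply/ler_addgt0Pr => e e0; rewrite add0r.
have Gf : G [set x | f x = Phi f].
  apply: FG; exists [:: f] => [h|x [_ Hx]]; first by rewrite inE => /eqP ->.
  by apply: Hx; rewrite mem_head.
have [x [/= <- h]] := filter_ex (filterI Gf (dual_converges UG df Sq cvq e0)).
exact: h.
Qed.

(** The barrel contains the polar of its prepolar [B]: an outside point would be separated from [A]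
    by some [Phi], and semi-reflexivity turns [Phi] into a point of [B]. *)
Lemma strong_dual_barrelled : semi_reflexive S N ->
  barrelled (dual S N) (strong_base S N).
Proof.
move=> HR A AD cA aA clA.
have A0 : A 0 by have /absorbsE [t [t0 /(_ 0 erefl) [x /(ac0 cA)]]] := aA _ HD.1.
pose B := [set x | S x /\ forall u, A u -> nm (u x) <= 1].
have bB : bounded S N B.
  apply: (weakly_bounded (s := s) HN); first by move=> x [].
  move=> f df; have /absorbsE [t [t0 /(_ f erefl) [u Au <-]]] := aA _ df.
  exists (nm t) => x [Sx /(_ _ Au)]; rewrite (_ : (t *: u) x = t * u x)// nmM => h.
  by rewrite -[leRHS]mulr1 ler_wpM2l ?nm_ge0.
exists (polar S N B); split; first by exists B.
move=> u [du Hu]; apply: contrapT => nAu.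
have [Phi [dPhi PA Pu]] := separation s (strong_lcH s HN) cA clA A0 du nAu.
have [x [Sx Px]] := HR _ dPhi.
have Bx : B x by split=> // v Av; rewrite -Px; [exact: PA|exact: AD].
have := Hu _ Bx; rewrite (nm_le1 s) -Px// => h.
by move: (le_lt_trans h Pu); rewrite ltxx.
Qed.

(** The hypothesis says that neighbourhoods of 0 are recognised on bounded sets. A Cauchy filter
    converges uniformly on bounded sets, so the unit ball of its pointwise limit passes this
    test. *)
Lemma strong_dual_complete :
  (forall U, U `<=` S -> absconvex U ->
    (forall B, bounded S N B -> exists W, N W /\ forall x, B x -> W x -> U x) ->
    nbhd0 N U) ->
  complete (dual S N) (strong_base S N).
Proof.
move=> loc F [FS F0 Fsub FI Fup] Fcau.
(* A [filter_on] contains only subsets of the dual, so it is first enlarged to a filter on all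
   functions. *)
have FF : Filter (filter_from F id).
  apply: filter_from_filter; first by exists (dual S N).
  by move=> A B FA FB; exists (A `&` B) => //; exact: FI.
have PF : ProperFilter (filter_from F id).
  apply: filter_from_proper => A FA; apply: contrapT => nA; apply: F0.
  by rewrite (_ : set0 = A)//; apply/esym/seteqP; split=> // x Ax; apply: nA; exists x.
have [G [UG FG]] := ultraFilterLemma PF.
have GF A : F A -> G A by move=> FA; apply: FG; exists A.
have cau B : bounded S N B -> exists A, [/\ F A, A `<=` dual S N &
    forall u v x, A u -> A v -> B x -> nm (u x - v x) <= 1].
  move=> bB; have [|A [FA HA]] := Fcau (polar S N B); first by exists B.
  exists A; split=> //; first exact: Fsub.
  by move=> u v x Au Av Bx; have [_ /(_ _ Bx)] := HA _ _ Au Av; rewrite (nm_le1 s).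
have [|x Sx|l [ll l0 Hl]] := functional_ultra_lim (s := s) HS UG (u := id).
- by apply: filterS (GF _ FS) => f /dual_linear.
- have [A [FA _ HA]] := cau _ (bounded1 HN Sx).
  have [u Au] := filter_ex (GF _ FA).
  exists (1 + nm (u x)); apply: filterS (GF _ FA) => v Av /=.
  rewrite -[v x](subrK (u x)); apply: le_trans (nmD _ _ _) _; rewrite lerD2r.
  exact: HA.
have liml A u x : F A -> (forall v, A v -> nm (v x - u x) <= 1) -> S x -> nm (l x - u x) <= 1.
  by move=> FA HA Sx; apply: (ultra_lim_le UG (Hl _ Sx)); apply: filterS (GF _ FA) => v; exact: HA.
have dl : dual S N l.
  split=> //.
  have [|||U [NU HU]] := loc [set x | S x /\ forall i : unit, setT i -> nm (l x) <= 1].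
  - by move=> x [].
  - by apply: linear_ball_ac => //; exact: HS.
  (* The unit Cauchy estimate is taken on [2 B]: there [l] differs from [u] by at most 1 and [u] is
     at most 1, whence [l] is at most 1 at [x] itself. *)
  - move=> B bB; have [A [FA AD HA]] := cau _ (bounded_scale HN 2 bB).
    have [u Au] := filter_ex (GF _ FA); have du := AD _ Au.
    have [W [NW HW]] := dual_small s HN du (ltr01 : 0 < 1 :> R).
    have [W' [NW' HW']] := lc_half HN NW.
    exists W'; split=> // x Bx Wx; have Sx := lc_sub HN NW' Wx; split=> // _ _.
    have S2x := subspaceZ HS 2 Sx.
    have h1 : nm (l (2 *: x) - u (2 *: x)) <= 1.
      by apply: (liml A) => // v Av; apply: HA => //; exists x.
    have h2 : nm (u (2 *: x)) <= 1.
      by apply: HW; rewrite -[2]/(1 + 1) scalerDl scale1r; exact: HW'.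
    have h3 : nm (l (2 *: x)) <= 2.
      rewrite -[l _](subrK (u (2 *: x))); apply: le_trans (nmD _ _ _) _; lra.
    move: h3; rewrite (linear_onZ HS ll)// [X in nm X](_ : _ = emb 2%:R * l x); last by rewrite emb_nat.
    by rewrite nmM nm_emb normr_nat; lra.
  by exists U; split=> // x /HU [_ /(_ tt I)]; rewrite -nm_le1.
exists l; split=> // _ [B [bB ->]]; have [A [FA AD HA]] := cau _ bB.
have BS := bounded_sub bB.
apply: (Fup _ _ FA).
  move=> u Au; apply/translateP; apply/(polarP s); first exact: (subspaceB HD (AD _ Au) dl).
  move=> x Bx; rewrite (_ : (u - l) x = u x - l x)// nm_distC.
  by apply: (liml A) => //; [move=> v Av; exact: HA|exact: BS].
by move=> _ [v [dv _] <-]; exact: (subspaceD HD dl dv).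
Qed.

End SemiReflexive.

(** * The mixed topology *)

Section Gamma.
Variables (R : realType) (K : numFieldType) (s : scalars R K).
Variables (V : lmodType K) (S : set V) (Ntau Nw : set (set V)).
Hypotheses (Ht : lcH S Ntau) (Hw : lcH S Nw).
Implicit Types (A B C U W : set V).
Local Notation HS := (lc_subspace Ht).

Lemma is_closed_coarser N1 N2 A : coarser N1 N2 -> is_closed S N1 A -> is_closed S N2 A.
Proof.
move=> h [AS cA]; split=> // a Sa nA; have [U [/h [W [NW WU]] /seteqP [H _]]] := cA _ Sa nA.
exists W; split=> //; apply/seteqP; split=> // x [/translateP xW Ax].
by apply: (H x); split=> //; apply/translateP; exact: WU.
Qed.

Lemma nbhd0_absorbs N U B : nbhd0 N U -> bounded S N B -> absorbs U B.
Proof. by move=> [W [NW WU]] [_ /(_ _ NW)]; exact: absorbsS. Qed.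

Lemma is_closed_scale N A (t : K) : lcH S N -> t != 0 -> is_closed S N A ->
  is_closed S N (scale_set t A).
Proof.
move=> HN t0 [AS cA]; have S' := lc_subspace HN; split=> [_ [x /AS Sx <-]|a Sa nA].
  exact: (subspaceZ S').
have [||U [NU /seteqP [H _]]] := cA (t^-1 *: a); first exact: (subspaceZ S').
  by move=> At; apply: nA; apply/scale_setP.
have [n Hn] := scalar_bound s (normr_ge0 t^-1); have [W [NW HW]] := lc_nat HN n NU.
exists W; split=> //; apply/seteqP; split=> // x [/translateP xW [y Ay yx]].
apply: (H y); split=> //; apply/translateP.
have -> : y - t^-1 *: a = t^-1 *: (x - a).
  by rewrite scalerBr -yx scalerA mulVf// scale1r.
have [n0|n0] := eqVneq n 0%N.
  by move: Hn; rewrite n0 normr_le0 invr_eq0 (negPf t0).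
have -> : t^-1 *: (x - a) = (t^-1 / n%:R) *: (n%:R *: (x - a)).
  by rewrite scalerA divfK// pnatr_eq0.
apply: (ac_scale (lc_ac HN NU)); last exact: HW.
by rewrite normrM [`|n%:R^-1|]normfV normr_nat ler_pdivrMr ?ltr0n ?lt0n// mul1r.
Qed.

(** If no multiple of [U] contained [C], an ultrafilter on [C] would avoid them all. Yet its limit
    lies in some [t U], so it contains a set inside [(t + 1) U]. *)
Lemma compact_bounded N C : lcH S N -> is_compact S N C -> bounded S N C.
Proof.
move=> HN kC; split=> [|U NU]; first by case: kC.
have cU := lc_ac HN NU.
apply: contrapT => nabs.
pose E n := [set x | C x /\ ~ scale_set n.+1%:R U x].
have FF : Filter (filter_from setT E).
  apply: filter_from_filter; first by exists 0%N.
  move=> i j _ _; exists (maxn i j) => // x [Cx nx].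
  split; split=> // xi; apply: nx; apply: (scale_set_le cU _ xi);
  by rewrite !normr_nat ler_nat ltnS ?leq_maxl ?leq_maxr.
have PF : ProperFilter (filter_from setT E).
  apply: filter_from_proper => n _; apply: contrapT => nE; apply: nabs.
  apply: (absorbsW (t := n.+1%:R)); rewrite ?ltr0n// => x Cx.
  by apply: contrapT => nx; apply: nE; exists x.
have [G [UG FG]] := ultraFilterLemma PF.
have GC : G C by apply: FG; exists 0%N => // x [].
have [a Ca cva] := compact_ultra HN kC UG GC.
have Sa : S a by case: kC => CS _; exact: CS.
have /absorbsE [t [t0 /(_ a erefl) aU]] := lc_absorbing HN NU Sa.
have [n Hn] := scalar_bound s (ltW t0).
have GE : G (E n) by apply: FG; exists n.
have [x [/translateP xa [Cx]]] := filter_ex (filterI (cva _ NU) GE); apply.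
rewrite -(subrK a x) -[x - a]scale1r -[X in _ + X]scale1r.
apply: (ac_comb (t1 := 1) (t2 := t)) => //; rewrite ?ltr0n ?(ltW t0)//.
  by exists (x - a); rewrite ?scale1r.
by rewrite normr1 !mul1r -natr1 addrC lerD2r.
Qed.

(** Only the origin is tested: agreement with [Nw] at another point [a] of [B] follows because
    [B - a] is bounded. Taking all such sets makes the base contain every competing one, which is
    the maximality of the mixed topology. *)
Definition gamma_base : set (set V) := [set U | [/\ U `<=` S, absconvex U &
  forall B, bounded S Ntau B -> exists W, Nw W /\ forall x, B x -> W x -> U x]].

Lemma sub_gamma_base U : Nw U -> gamma_base U.
Proof.
move=> NU; split; [exact: (lc_sub Hw)|exact: (lc_ac Hw)|].
by move=> B _; exists U; split.
Qed.

Lemma gamma_base_absorbing U : gamma_base U -> absorbing S U.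
Proof.
move=> [US cU loc] x Sx.
have [W [NW HW]] := loc _ (bounded_acx_hull Ht (bounded1 Ht Sx)).
have /absorbsE [t [t0 /(_ x erefl) xW]] := lc_absorbing Hw NW Sx.
(* The added 1 makes the inverse factor at most 1, so the rescaled point stays in the hull of [x] as
   well as in [W]. *)
have T0 : 0 < t + 1 by rewrite ltr_wpDl// ltW.
apply: (absorbsW (t := t + 1)) => // _ ->; apply/scale_setP; first by rewrite gt_eqF.
apply: HW.
  apply: (ac_scale (@acx_hull_ac _ _ _)); last exact: sub_acx_hull.
  by rewrite normfV gtr0_norm// invf_le1// lerDr ltW.
apply/scale_setP; first by rewrite gt_eqF.
apply: (scale_set_le (lc_ac Hw NW) _ xW).
by rewrite !gtr0_norm// lerDl.
Qed.

Lemma gamma_base_lcH : lcH S gamma_base.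
Proof.
split.
- split; first exact: HS.
  by have [[_ [U NU]] _ _ _ _] := Hw; exists U; exact: sub_gamma_base.
- by move=> U gU; have [US cU _] := gU; split=> //; exact: gamma_base_absorbing.
- move=> U1 U2 [US1 cU1 l1] [US2 cU2 l2]; exists (U1 `&` U2); split=> //; split.
  + by move=> x [/US1].
  + exact: acI.
  + move=> B bB; have [W1 [NW1 H1]] := l1 _ bB; have [W2 [NW2 H2]] := l2 _ bB.
    have [W [NW HW]] := lc_inter Hw NW1 NW2; exists W; split=> // x Bx /HW [x1 x2].
    by split; [exact: H1|exact: H2].
- move=> U [US cU l]; exists (scale_set 2^-1 U); split; last first.
    by move=> _ [_ [x Ux <-] <-]; rewrite scalerA divff ?pnatr_eq0// scale1r.
  split; [by move=> _ [x /US Sx <-]; exact: (subspaceZ HS)|exact: ac_scale_set|].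
  move=> B bB; have [W [NW HW]] := l _ (bounded_scale Ht 2 bB).
  have [W' [NW' HW']] := lc_half Hw NW; exists W'; split=> // x Bx Wx.
  apply/scale_setP; first by rewrite invr_eq0 pnatr_eq0.
  rewrite invrK; apply: HW; first by exists x.
  by rewrite -[2]/(1 + 1) scalerDl scale1r; exact: HW'.
- move=> x Sx x0; have [_ _ _ _ /(_ _ Sx x0) [U [NU nU]]] := Hw.
  by exists U; split=> //; exact: sub_gamma_base.
Qed.

Lemma gamma_base_is_gamma : is_gamma S Ntau Nw gamma_base.
Proof.
split; first exact: gamma_base_lcH.
- move=> B bB a Ba; split=> U NU; first by exists U; split=> //; exact: sub_gamma_base.
  have Sa : S a by case: bB => BS _; exact: BS.
  have [_ _ l] := NU; have [W [NW HW]] := l _ (bounded_diff Ht Sa bB).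
  exists W; split=> // x [Bx Wx]; split=> //; apply: HW => //.
  by exists x.
- move=> Ns HNs co U NU; exists U; split=> //; split; [exact: (lc_sub HNs)|exact: (lc_ac HNs)|].
  move=> B bB; have [_ /(_ _ NU) [W [NW HW]]] := co _ (bounded0U Ht bB) 0 (or_introl erefl).
  exists W; split=> // x Bx Wx; have := HW x; rewrite /= subr0.
  by case=> //; split=> //; right.
Qed.

(** [is_gamma] fixes [Ng] only up to equivalence of bases; this makes it concrete. The last clause
    holds because [Nw] itself competes in the maximality condition. *)
Lemma is_gammaP Ng : is_gamma S Ntau Nw Ng ->
  [/\ Ng `<=` gamma_base, coarser gamma_base Ng & coarser Nw Ng].
Proof.
move=> [HNg co fin]; split.
- move=> U NU; split; [exact: (lc_sub HNg)|exact: (lc_ac HNg)|].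
  move=> B bB; have [_ /(_ _ NU) [W [NW HW]]] := co _ (bounded0U Ht bB) 0 (or_introl erefl).
  exists W; split=> // x Bx Wx; have := HW x; rewrite /= subr0.
  by case=> //; split=> //; right.
- by have [h1 h2 _] := gamma_base_is_gamma; exact: fin.
- apply: fin => // B bB a Ba; split=> U NU; exists U; split=> //.
Qed.

(** This is the locality required by [strong_dual_complete]: on a bounded set, an [Ng]-neighbourhood
    contains the trace of an [Nw]-neighbourhood, so the test reduces to membership in
    [gamma_base]. *)
Lemma is_gamma_local Ng : is_gamma S Ntau Nw Ng -> forall U, U `<=` S -> absconvex U ->
  (forall B, bounded S Ntau B -> exists W, Ng W /\ forall x, B x -> W x -> U x) ->
  nbhd0 Ng U.
Proof.
move=> /is_gammaP [sub co _] U US cU loc.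
have [|W [NW WU]] := co U; last by exists W.
split=> // B bB; have [W [/sub [_ _ lW] HW]] := loc _ bB.
by have [W' [NW' HW']] := lW _ bB; exists W'; split=> // x Bx Wx; apply: HW => //; exact: HW'.
Qed.

(** On a bounded set the two topologies agree, so [Nw]-limits of ultrafilters on [C] are limits for
    the mixed topology. *)
Lemma gamma_base_compact C : bounded S Ntau C -> is_compact S Nw C ->
  is_compact S gamma_base C.
Proof.
move=> bC kC; apply: ultra_compact => [|G UG GC]; first by case: kC.
have [a Ca cva] := compact_ultra Hw kC UG GC; exists a => // U NU.
have Sa : S a by case: bC => CS _; exact: CS.
have [_ _ l] := NU; have [W [NW HW]] := l _ (bounded_diff Ht Sa bC).
apply: filterS (filterI GC (cva _ NW)) => x [Cx /translateP xW]; apply/translateP.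
by apply: HW => //; exists x.
Qed.

(* If a [gamma]-bounded [B] escaped all multiples of the closed [Ntau]-neighbourhood [W],
   say [xs n] in [B] outside [4^n W], choose weak neighbourhoods [Vs n] with [2^-n xs n]
   outside [2^n W + Vs n]: the intersection of these sets is a [gamma]-neighbourhood
   (a [Ntau]-bounded set lies in [2^n W] for large [n]) that does not absorb [B]. *)
Lemma gamma_base_bounded B : BBC S Ntau Nw -> CNC S Ntau Nw -> B `<=` S ->
  bounded S Ntau B <-> bounded S gamma_base B.
Proof.
move=> bbc cnc BS; split=> bB; split=> // U NU.
  have [C [BC cC bC kC]] := bbc _ bB.
  have [US cU l] := NU; have [W [NW HW]] := l _ bC.
  have [_ /(_ _ NW) /absorbsE [t [t0 CW]]] := compact_bounded Hw kC.
  have T0 : 0 < t + 1 by rewrite ltr_wpDl// ltW.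
  apply: (absorbsW (t := t + 1)) => // x /BC Cx; apply/scale_setP; first by rewrite gt_eqF.
  apply: HW.
    by apply: ac_scale => //; rewrite normfV gtr0_norm// invf_le1// lerDr ltW.
  apply/scale_setP; first by rewrite gt_eqF.
  by apply: (scale_set_le (lc_ac Hw NW) _ (CW _ Cx)); rewrite !gtr0_norm// lerDl.
have [|W [WU nW cW clW]] := cnc U; first by exists U; split.
apply: (absorbsS WU (fun x Bx => Bx)); apply: contrapT => nabs.
have W0 : W 0 by have [U' [NU' U'W]] := nW; apply: U'W; exact: (lc0 Ht).
have p2 n : 2 ^+ n != 0 :> K by rewrite expf_neq0 ?pnatr_eq0.
have p2g n : 0 < 2 ^+ n :> K by rewrite exprn_gt0 ?ltr0n.
have np2 n : n%:R <= 2 ^+ n :> K by rewrite -natrX ler_nat ltnW// ltn_expl.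
have /choice [xs Hxs] : forall n, exists x, B x /\ ~ scale_set (2 ^+ n) W ((2 ^+ n)^-1 *: x).
  move=> n; apply: contrapT => H; apply: nabs.
  apply: (absorbsW (t := 2 ^+ n * 2 ^+ n)); [by []|exact: mulr_gt0|].
  move=> x Bx; apply: contrapT => nx; apply: H; exists x; split=> // /(scale_setP _ _ (p2 n)).
  rewrite scalerA -invfM => Wx; apply: nx; apply/scale_setP => //.
  by rewrite mulf_neq0.
have Sxs n : S ((2 ^+ n)^-1 *: xs n).
  by apply: (subspaceZ HS); apply: BS; exact: (Hxs n).1.
have /choice [Vs HVs] : forall n, exists V', Nw V' /\
    translate ((2 ^+ n)^-1 *: xs n) V' `&` scale_set (2 ^+ n) W = set0.
  move=> n; have [_ /(_ _ (Sxs n))] := is_closed_scale Hw (p2 n) clW.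
  by apply; exact: (Hxs n).2.
pose D n := [set z | exists w v, [/\ scale_set (2 ^+ n) W w, Vs n v & z = w + v]].
have NVs n : Nw (Vs n) by exact: (HVs n).1.
pose U' := [set z | S z /\ forall n, D n z].
have gU' : gamma_base U'.
  split; first by move=> z [].
    move=> a c x y [Sx Dx] [Sy Dy] ac; split; first exact: (absconvex_subspace HS).
    move=> n; have [w [v [Ww Vv ->]]] := Dx n; have [w' [v' [Ww' Vv' ->]]] := Dy n.
    exists (a *: w + c *: w'), (a *: v + c *: v'); split.
    - exact: (@ac_scale_set _ _ W (2 ^+ n) cW).
    - exact: (lc_ac Hw (NVs n)).
    - by rewrite !scalerDr addrACA.
  move=> C bC; have /absorbsE [t [t0 CW]] := nbhd0_absorbs nW bC.
  have [m Hm] := scalar_bound s (ltW t0).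
  (* Since [C] lies in [2 ^+ n] times [W] for all [n >= m], only the finitely many [Vs n] with
     [n < m] restrict the neighbourhood. *)
  have [W1 [NW1 HW1]] : exists W1, Nw W1 /\ forall n, (n < m)%N -> W1 `<=` Vs n.
    elim: (m) => [|k [W1 [NW1 H1]]].
      by have [[_ [W1 NW1]] _ _ _ _] := Hw; exists W1.
    have [W2 [NW2 H2]] := lc_inter Hw NW1 (NVs k); exists W2; split=> // n.
    by rewrite ltnS leq_eqVlt => /orP[/eqP ->|/H1 h] x /H2 [] // /h.
  exists W1; split=> // x Cx W1x; split; first by case: bC => CS _; exact: CS.
  move=> n; have [nm|mn] := ltnP n m.
    exists 0, x; split; [by exists 0; rewrite ?scaler0|exact: HW1|by rewrite add0r].
  exists x, 0; split; [|exact: (lc0 Hw)|by rewrite addr0].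
  apply: (scale_set_le cW _ (CW _ Cx)); rewrite gtr0_norm// gtr0_norm//.
  by apply: le_trans (le_trans Hm _) (np2 n); rewrite ler_nat.
have [_ /(_ _ gU') /absorbsE [t [t0 BU]]] := bB.
(* If [t] times [U'] contained [B], then for [n >= t] the point [(2 ^+ n)^-1 *: xs n] would lie in
   [U'], hence in [D n], which excludes it. *)
have [n Hn] := scalar_bound s (ltW t0).
have : scale_set (2 ^+ n) U' (xs n).
  apply: (scale_set_le _ _ (BU _ (Hxs n).1)); first by case: gU'.
  by rewrite !gtr0_norm//; apply: le_trans Hn (np2 n).
move=> /(scale_setP _ _ (p2 n)) [_ /(_ n) [w [v [Ww Vv xE]]]].
have [_ /seteqP [H _]] := HVs n; apply: (H w); split=> //; apply/translateP.
by rewrite xE opprD addrA subrr add0r; apply: acN => //; exact: (lc_ac Hw (NVs n)).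
Qed.

End Gamma.

(** * Linearisations and prebiduals *)

Section Linearisation.
Variables (R : realType) (K : numFieldType) (s : scalars R K).
Variables (Omega : Type) (F : set (Omega -> K^o)) (Ntau : set (set (Omega -> K^o))).
Hypotheses (Ht : lcH F Ntau) (Hborn : bornological F Ntau).
Local Notation emb := (emb s).
Local Notation nm := (knorm s).
Local Notation V := (Omega -> K^o).
Local Notation HS := (lc_subspace Ht).

Definition evaluation (Ng : set (set V)) (f : V) : (V -> K^o) -> K^o :=
  restr (dual F Ng) (fun u => u f).

Definition point_evaluation (x : Omega) : V -> K^o := restr F (fun f => f x).

Section Predual.
Variable Ng : set (set V).
Hypotheses (Hg : lcH F Ng) (Hcnc : CNC F Ntau Ng) (Hbb : BtBg F Ntau Ng)
  (Hpt : forall x, nbhd0 Ng [set f | nm (f x) <= 1]) (Hsr : semi_reflexive F Ng).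
Local Notation T := (evaluation Ng).
Local Notation Y := (dual F Ng).
Local Notation bY := (strong_base F Ng).

Lemma point_evaluation_dual x : Y (point_evaluation x).
Proof. by apply: (restr_dual (s := s) Hg) => //; exact: Hpt. Qed.

Lemma evaluation_dual f : F f -> dual Y bY (T f).
Proof.
move=> Ff; apply: (restr_dual (s := s) (strong_lcH s Hg)) => //.
exists (polar F Ng [set f]); split; first by exists [set f]; split=> //; exact: (bounded1 Hg).
by move=> u [_ /(_ f erefl)]; rewrite (nm_le1 s).
Qed.

Lemma evaluation_surj Phi : dual Y bY Phi -> exists f, F f /\ T f = Phi.
Proof.
move=> dPhi; have [f [Ff Pf]] := Hsr dPhi; exists f; split=> //.
apply: (dual_ext (evaluation_dual Ff) dPhi) => u du.
by rewrite /evaluation restrE// Pf.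
Qed.

Lemma evaluation_top_iso : top_iso F Ntau (dual Y bY) (strong_base Y bY) T.
Proof.
split; first split.
- move=> a f g Ff Fg; apply/funext => u.
  rewrite (_ : (a *: T f + T g) u = a *: T f u + T g u)// /evaluation.
  have [du|du] := pselect (Y u); first by rewrite !restrE// (dual_linear du).
  by rewrite !restr_out// scaler0 addr0.
- exact: evaluation_dual.
- exact: evaluation_surj.
(* Injectivity holds because the point evaluations belong to the predual. *)
- move=> f g Ff Fg fg; apply/funext => x; have := congr1 (fun h => h (point_evaluation x)) fg.
  by rewrite /evaluation !restrE ?/point_evaluation ?restrE//; exact: point_evaluation_dual.
(* The prepolar of a strongly bounded [D] absorbs every [Ng]-bounded set, hence every [Ntau]-bounded
   one; bornologicity makes it a neighbourhood. *)
- move=> _ [D [bD ->]]; have [DY HD] := (strong_boundedP s Hg D).1 bD.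
  pose A := [set f | F f /\ forall u, D u -> nm (u f) <= 1].
  have cA : absconvex A.
    by apply: linear_ball_ac => // [|u /DY /dual_linear]; first exact: HS.
  have [||B bB|U [NU UA]] := Hborn (A := A).
  + by move=> f [].
  + exact: cA.
  + have [BF _] := bB; have [M M0 HM] := HD _ ((Hbb BF).1 bB).
    apply: (absorbsW (t := emb M)) => //; first by rewrite emb_gt0.
    move=> f Bf; apply/scale_setP; first by rewrite emb_eq0 gt_eqF.
    have Ff := BF _ Bf; split; first exact: (subspaceZ HS).
    move=> u Du; rewrite (linear_onZ HS (dual_linear (DY _ Du)))//.
    by rewrite -embV [nm _]nmM nm_emb gtr0_norm ?invr_gt0// ler_pdivrMl// mulr1 HM.
  exists U; split=> // _ [f Uf <-]; have [Ff Hf] := UA _ Uf.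
  apply/(polarP s); first exact: evaluation_dual.
  by move=> u Du; rewrite /evaluation restrE; [exact: Hf|exact: DY].
(* The closed neighbourhood [W] absorbs bounded sets, so its polar [D] is strongly bounded; by
   separation, the functions whose evaluation lies in the polar of [D] are in [W]. *)
- move=> U1 NU1; have [|W [WU nW cW clW]] := Hcnc (U := U1); first by exists U1; split.
  have W0 : W 0 by have [U' [NU' U'W]] := nW; apply: U'W; exact: (lc0 Ht).
  have WF : W `<=` F by case: clW.
  pose D := [set u | Y u /\ forall f, W f -> nm (u f) <= 1].
  exists (polar Y bY D); split.
    exists D; split=> //; apply/(strong_boundedP s Hg); split; first by move=> u [].
    move=> B bB; have BF := bounded_sub bB.
    have /absorbsE [t [t0 BW]] := nbhd0_absorbs nW ((Hbb BF).2 bB).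
    exists (re s t); first by rewrite -(emb_gt0 s) -emb_re// ltW.
    move=> u f [du Du] Bf; apply: (dual_scale_bound Hg (dual_linear du) WF t0 Du).
    exact: BW.
  move=> Phi [dPhi HPhi]; have [f [Ff TfE]] := evaluation_surj dPhi.
  exists f => //; apply: WU; apply: contrapT => nWf.
  have [u [du uW uf]] := separation s Hg cW clW W0 Ff nWf.
  have := HPhi u (conj du uW); rewrite -TfE /evaluation restrE// (nm_le1 s) => h.
  by move: (le_lt_trans h uf); rewrite ltxx.
Qed.

Lemma predual_linearisation : complete Y bY -> admits_scb_linearisation F Ntau.
Proof.
move=> cY; have topT := evaluation_top_iso.
exists (V -> K^o : lmodType K), Y, bY, point_evaluation, T; split=> //.
- exact: (strong_lcH s Hg).
- split=> //; split; [exact: point_evaluation_dual|by case: topT|].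
  move=> f Ff x; rewrite /evaluation restrE; last exact: point_evaluation_dual.
  by rewrite /point_evaluation restrE.
- exact: (strong_dual_barrelled s Hg).
Qed.

(** The space [F] with [Ng] is its own prebidual: [T] maps onto its strong bidual. The representing
    functional is unique because [T f y'] is just [y' f]. *)
Lemma predual_prebidual : prebidual F Ntau F Ng T /\
  forall x, exists! y' : V -> K^o, Y y' /\ forall f, F f -> T f y' = f x.
Proof.
split; first by split=> //; exact: evaluation_top_iso.
move=> x; have dx := point_evaluation_dual x; exists (point_evaluation x); split.
  by split=> // f Ff; rewrite /evaluation restrE// /point_evaluation restrE.
move=> y [dy Hy]; apply: (dual_ext dx dy) => f Ff.
by rewrite /point_evaluation restrE// -(Hy _ Ff) /evaluation restrE.
Qed.

End Predual.

(** The closed absolutely convex hull of a bounded set is compact and supplies the enclosing set. *)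
Lemma semi_montel_semi_reflexive (W : lmodType K) (S : set W) (N : set (set W)) :
  lcH S N -> semi_montel S N -> semi_reflexive S N.
Proof.
move=> HN SM; apply: (compact_semi_reflexive s HN) => B bB.
exists (Defs.closure S N (acx_hull B)); split.
- apply: subset_trans (@sub_acx_hull _ _ B) _; apply: (sub_closure HN).
  by case: (bounded_acx_hull HN bB).
- by apply: (closure_ac HN); exact: acx_hull_ac.
- by apply: SM; exact: (bounded_acx_hull HN).
Qed.

Lemma prebidual_linearisation (W : lmodType K) (S : set W) (N : set (set W)) phi :
  prebidual F Ntau S N phi -> semi_montel S N -> complete (dual S N) (strong_base S N) ->
  (forall x : Omega, exists! y' : W -> K^o,
     dual S N y' /\ forall f, F f -> phi f y' = f x) ->
  admits_scb_linearisation F Ntau.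
Proof.
move=> [HN tphi] SM cY uY.
have /choice [d Hd] : forall x, exists y : W -> K^o,
    dual S N y /\ forall f, F f -> phi f y = f x.
  by move=> x; have [y [Hy _]] := uY x; exists y.
exists (W -> K^o : lmodType K), (dual S N), (strong_base S N), d, phi; split=> //.
- exact: (strong_lcH s HN).
- split=> //; split; [by move=> x; exact: (Hd x).1|by case: tphi|].
  by move=> f Ff x; exact: (Hd x).2.
- by apply: (strong_dual_barrelled s HN); exact: semi_montel_semi_reflexive.
Qed.

(** The weak topology of the dual of [W], tested on points of [S] and transported to [F] along
    [T]. *)
Definition initial_base (W : lmodType K) (S : set W) (T : V -> W -> K^o) : set (set V) :=
  [set U | exists (ys : seq W) (e : R), [/\ 0 < e, {in ys, forall y, S y} &
    U = [set f | F f /\ {in ys, forall y, nm (T f y) <= e}]]].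

(** * The weak topology induced by a strong barrelled linearisation *)

Section StrongLinearisation.
Variables (W : lmodType K) (S : set W) (N : set (set W)).
Variables (delta : Omega -> W) (T : V -> W -> K^o).
Hypotheses (HN : lcH S N) (HT : strong_linearisation F Ntau S N delta T)
  (HB : barrelled S N).
Local Notation Nw := (initial_base S T).

Let Tdual f : F f -> dual S N (T f).
Proof. by have [[_ [_ h _ _] _] _] := HT; exact: h. Qed.

Let TZE a f y : F f -> T (a *: f) y = a * T f y.
Proof.
by move=> Ff; have [[_ [h _ _ _] _] _] := HT; rewrite (linear_onZ HS h).
Qed.

Let TBE f g y : F f -> F g -> T (f - g) y = T f y - T g y.
Proof.
by move=> Ff Fg; have [[_ [h _ _ _] _] _] := HT; rewrite (linear_onB HS h).
Qed.

Let Tinj f g : F f -> F g -> T f = T g -> f = g.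
Proof. by have [[_ [_ _ _ h] _] _] := HT; exact: h. Qed.

Let Tsurj u : dual S N u -> exists f, F f /\ T f = u.
Proof. by have [[_ [_ _ h _] _] _] := HT; exact: h. Qed.

Let ball_ac (P : set W) (e : R) : 0 <= e ->
  absconvex [set f | F f /\ forall y, P y -> nm (T f y) <= e].
Proof.
move=> e0; apply: (linear_ball_ac (u := fun y f => T f y)) => //; first exact: HS.
by move=> y _ a f g Ff Fg; have [[_ [h _ _ _] _] _] := HT; rewrite h.
Qed.

Lemma initial_base_lcH : lcH F Nw.
Proof.
split.
- split; first exact: HS.
  by exists [set f | F f /\ {in [::], forall y, nm (T f y) <= 1}], [::], 1.
- move=> _ [ys [e [e0 Sys ->]]].
  have cU := @ball_ac [set y | y \in ys] e (ltW e0).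
  split; [by move=> f []|exact: cU|move=> f Ff].
  pose M := \sum_(y <- ys) nm (T f y).
  have M0 : 0 <= M by apply: sumr_ge0 => y _; exact: nm_ge0.
  have T0 : 0 < (M + 1) / e by rewrite divr_gt0// ltr_wpDl.
  apply: (absorbsW (t := emb ((M + 1) / e))); [exact: cU|by rewrite emb_gt0|].
  move=> _ ->; apply/scale_setP; first by rewrite emb_eq0 gt_eqF.
  split; first exact: (subspaceZ HS).
  move=> y yys; rewrite TZE// -embV nmM nm_emb gtr0_norm ?invr_gt0// ler_pdivrMl//.
  rewrite divfK ?gt_eqF//; apply: (@le_trans _ _ M); last by rewrite lerDl.
  by rewrite /M (big_rem y)//= lerDl sumr_ge0// => z _; exact: nm_ge0.
- move=> _ _ [y1 [e1 [e10 S1 ->]]] [y2 [e2 [e20 S2 ->]]].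
  exists [set f | F f /\ {in y1 ++ y2, forall y, nm (T f y) <= Num.min e1 e2}]; split.
    exists (y1 ++ y2), (Num.min e1 e2); split=> //; first by rewrite lt_min e10.
    by move=> y; rewrite mem_cat => /orP[/S1|/S2].
  move=> f [Ff Hf]; split; split=> // y yy; have := Hf y; rewrite mem_cat yy ?orbT => /(_ isT);
  by rewrite le_min => /andP[].
- move=> _ [ys [e [e0 Sys ->]]].
  exists [set f | F f /\ {in ys, forall y, nm (T f y) <= e / 2}]; split.
    by exists ys, (e / 2); rewrite divr_gt0.
  move=> _ [f [Ff Hf] <-]; split; first exact: (subspaceZ HS).
  move=> y yys; rewrite TZE// -(emb_nat s) nmM nm_emb normr_nat mulrC -ler_pdivlMr//.
  exact: Hf.
- move=> f Ff /eqP f0; have [y [Sy Ty]] : exists y, S y /\ T f y != 0.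
    apply: contrapT => H; apply: f0; apply: Tinj => //; first exact: (subspace0 HS).
    apply: (dual_ext (Tdual Ff) (Tdual (subspace0 HS))) => y Sy.
    have -> : T 0 y = 0 by rewrite -(scale0r f) TZE// mul0r.
    by apply/eqP; apply: contrapT => /negP Ty; apply: H; exists y.
  have n0 : 0 < nm (T f y) by rewrite lt_neqAle eq_sym nm_eq0 Ty nm_ge0.
  exists [set g | F g /\ {in [:: y], forall z, nm (T g z) <= nm (T f y) / 2}]; split.
    by exists [:: y], (nm (T f y) / 2); rewrite divr_gt0//; split=> // z; rewrite inE => /eqP ->.
  by move=> [_ /(_ y)]; rewrite mem_head => /(_ isT); lra.
Qed.

Lemma pointwise_coarser_initial : coarser (pointwise_base F) Nw.
Proof.
move=> _ [xs [e [e0 ->]]]; have e0' : 0 < re s e by rewrite -(emb_gt0 s) -emb_re// ltW.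
have [[Sdelta _ Tdelta] _] := HT.
exists [set f | F f /\ {in [seq delta x | x <- xs], forall y, nm (T f y) <= re s e}]; split.
  exists [seq delta x | x <- xs], (re s e); split=> // y.
  by elim: xs => //= z xs IH; rewrite in_cons => /orP[/eqP ->|/IH].
move=> f [Ff Hf]; split=> // x xxs; rewrite (emb_re s (ltW e0)) (nm_le s) -Tdelta//.
apply: Hf; elim: xs xxs => //= z xs IH; rewrite in_cons => -[->|/IH ->]; rewrite ?eqxx ?orbT//.
Qed.

(** Strong neighbourhoods are polars of bounded sets [D], and a polar is cut out by conditions at
    single points of [D], each weakly closed. *)
Lemma initial_CNC : CNC F Ntau Nw.
Proof.
have [_ [_ Tc To]] := HT.
move=> U [U1 [NU1 U1U]]; have [_ [[D [bD ->]] HD]] := To _ NU1.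
have [DS _] := bD.
pose C := [set f | F f /\ forall y, D y -> nm (T f y) <= 1].
have CE f : F f -> C f <-> polar S N D (T f).
  move=> Ff; split=> [[_ Hf]|]; first by apply/(polarP s); [exact: Tdual|].
  by move=> /(polarP s _ (Tdual Ff)).
exists C; split.
- move=> f Cf; apply: U1U; have Ff : F f by case: Cf.
  have [g U1g gf] := HD _ ((CE _ Ff).1 Cf).
  by rewrite -(Tinj (lc_sub Ht NU1 U1g) Ff gf).
- have [|U2 [NU2 HU2]] := Tc (polar S N D); first by exists D.
  exists U2; split=> // f U2f; apply/(CE _ (lc_sub Ht NU2 U2f)); apply: HU2.
  by exists f.
- exact: ball_ac.
- split=> [f []//|f Ff nC].
  have [y [Dy fy]] : exists y, D y /\ 1 < nm (T f y).
    apply: contrapT => H; apply: nC; split=> // y Dy; rewrite leNgt; apply/negP => fy.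
    by apply: H; exists y.
  exists [set g | F g /\ {in [:: y], forall z, nm (T g z) <= (nm (T f y) - 1) / 2}]; split.
    exists [:: y], ((nm (T f y) - 1) / 2); split=> //; first by rewrite divr_gt0// subr_gt0.
    by move=> z; rewrite inE => /eqP ->; exact: DS.
  apply/seteqP; split=> // g [/translateP [_ Hgf] [Fg /(_ _ Dy) gy]].
  have := Hgf y (mem_head _ _); rewrite TBE//.
  have := nmB s (T g y) (T g y - T f y); rewrite opprB addrC subrK; lra.
Qed.

Lemma initial_BBC : BBC F Ntau Nw.
Proof.
have [_ [_ Tc To]] := HT.
move=> B [BF HB'].
pose A := [set y | S y /\ forall f, B f -> nm (T f y) <= 1].
have cA : absconvex A.
  apply: linear_ball_ac => // [|f /BF /Tdual /dual_linear //]; exact: (lc_subspace HN).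
have AS : A `<=` S by move=> y [].
(* The prepolar of the image of [B] is a barrel: it is absorbing because a bounded set of
   functionals is bounded at each point. *)
have [||U [NU UA]] := HB AS cA.
- move=> y Sy; have [|U2 [NU2 HU2]] := Tc (polar S N [set y]).
    by exists [set y]; split=> //; exact: (bounded1 HN).
  have /absorbsE [t [t0 BU]] := HB' _ NU2.
  apply: (absorbsW (t := t)) => // _ ->; apply/scale_setP; first by rewrite gt_eqF.
  split; first exact: (subspaceZ (lc_subspace HN)).
  move=> f Bf; have [g Ug gf] := BU _ Bf; have Fg := lc_sub Ht NU2 Ug.
  rewrite (linear_onZ (lc_subspace HN) (dual_linear (Tdual (BF _ Bf))))// -gf TZE//.
  rewrite /GRing.scale /= mulrA mulVf ?gt_eqF// mul1r.
  have [|_ /(_ _ erefl)] := HU2 (T g); first by exists g.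
  by rewrite (nm_le1 s).
- split=> [y []//|y Sy nAy].
  have [f [Bf fy]] : exists f, B f /\ 1 < nm (T f y).
    apply: contrapT => H; apply: nAy; split=> // f Bf; rewrite leNgt; apply/negP => fy.
    by apply: H; exists f.
  have df := Tdual (BF _ Bf).
  have e0 : 0 < (nm (T f y) - 1) / 2 by rewrite divr_gt0// subr_gt0.
  have [U [NU HU]] := dual_small s HN df e0; exists U; split=> //.
  apply/seteqP; split=> // z [/translateP zU [Sz /(_ _ Bf) fz]].
  have := HU _ zU; rewrite (linear_onB (lc_subspace HN) (dual_linear df))//.
  have := nmB s (T f z) (T f z - T f y); rewrite opprB addrC subrK; lra.
pose C := [set f | F f /\ forall y, U y -> nm (T f y) <= 1].
exists C; split.
- by move=> f Bf; split=> [|y /UA [_]]; [exact: BF|exact].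
- exact: ball_ac.
(* Some multiple of [U] contains [D], so the polar of [U] lies in that multiple of the polar of
   [D]. *)
- split=> [f []//|U1 NU1]; have [_ [[D [bD ->]] HD]] := To _ NU1.
  have [_ /(_ _ NU) /absorbsE [t [t0 DU]]] := bD.
  apply: (absorbsW (t := t)) => // [|f [Ff Hf]]; first exact: (lc_ac Ht).
  have Ftf := subspaceZ HS t^-1 Ff.
  apply/scale_setP; first by rewrite gt_eqF.
  have [|g U1g gf] := HD (T (t^-1 *: f)).
    apply/(polarP s); [exact: Tdual|move=> y /DU [z Uz <-]].
    rewrite TZE// (linear_onZ (lc_subspace HN) (dual_linear (Tdual Ff))); last exact: (lc_sub HN) Uz.
    by rewrite /GRing.scale /= mulrA mulVf ?gt_eqF// mul1r; exact: Hf.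
  by rewrite -(Tinj (lc_sub Ht NU1 U1g) Ftf gf).
(* Alaoglu's theorem: the pointwise limit is bounded by 1 on [U], hence continuous, and surjectivity
   of [T] brings it back to [F]. *)
- apply: ultra_compact => [f []//|G UG GC].
  have [|y Sy|l [ll l0 Hl]] := functional_ultra_lim (s := s) (lc_subspace HN) UG (u := T).
  + by apply: filterS GC => f [Ff _]; exact: (dual_linear (Tdual Ff)).
  + have /absorbsE [t [t0 /(_ _ erefl) [z Uz zy]]] := lc_absorbing HN NU Sy.
    exists (nm t); apply: filterS GC => f [Ff Hf] /=; rewrite -zy.
    rewrite (linear_onZ (lc_subspace HN) (dual_linear (Tdual Ff))); last exact: (lc_sub HN) Uz.
    by rewrite [nm _]nmM -[leRHS]mulr1 ler_wpM2l ?nm_ge0// Hf.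
  have lU y : U y -> nm (l y) <= 1.
    move=> Uy; have Sy := lc_sub HN NU Uy; rewrite -[l y]subr0.
    apply: (ultra_lim_le UG (Hl _ Sy)); apply: filterS GC => f [_ Hf].
    by rewrite /= subr0; exact: Hf.
  have dl : dual S N l.
    by split=> //; exists U; split=> // y /lU; rewrite (nm_le1 s).
  have [f [Ff fl]] := Tsurj dl; exists f; first by split=> // y Uy; rewrite fl; exact: lU.
  move=> _ [ys [e [e0 Sys ->]]].
  have : G [set g | F g /\ {in ys, forall y, nm (T g y - l y) <= e}].
    elim: ys Sys => [|y ys IH] Sys.
      by apply: filterS GC => g [Fg _]; split=> // z; rewrite in_nil.
    have Gy := Hl _ (Sys _ (mem_head _ _)) _ e0.
    have /(filterI Gy) : G [set g | F g /\ {in ys, forall y, nm (T g y - l y) <= e}].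
      by apply: IH => z zys; apply: Sys; rewrite in_cons zys orbT.
    apply: filterS => g [/= h1 [Fg h2]]; split=> // z.
    by rewrite in_cons => /orP[/eqP ->//|]; exact: h2.
  apply: filterS => g [Fg Hg]; apply/translateP; split; first exact: (subspaceB HS).
  by move=> y yys; rewrite TBE// fl; exact: Hg.
Qed.

End StrongLinearisation.
End Linearisation.

(** * Implications between the six assertions *)

Section Equivalences.
Variables (R : realType) (K : numFieldType) (s : scalars R K).
Variables (Omega : Type) (F : set (Omega -> K^o)) (Ntau : set (set (Omega -> K^o))).
Hypotheses (Ht : lcH F Ntau) (Hborn : bornological F Ntau).
Local Notation nm := (knorm s).
Local Notation V := (Omega -> K^o).

Lemma CNC_coarser Nw Ng : coarser Nw Ng -> CNC F Ntau Nw -> CNC F Ntau Ng.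
Proof.
move=> co cnc U /cnc [W [WU nW cW clW]]; exists W; split=> //.
exact: is_closed_coarser clW.
Qed.

Lemma coarser_pointwise_nbhd Nw Ng x : coarser (pointwise_base F) Nw -> coarser Nw Ng ->
  nbhd0 Ng [set f | nm (f x) <= 1].
Proof.
move=> co co'; have [|W [/co' [W' [NW' W'W]] HW]] :=
  co [set f : V | F f /\ forall y, List.In y [:: x] -> `|(f y : K)| <= 1].
  by exists [:: x], 1.
exists W'; split=> // f /W'W /HW [_ /(_ x)]; rewrite (nm_le1 s); apply; by left.
Qed.

Lemma gamma_semi_montel Nw : lcH F Nw -> BBC F Ntau Nw -> CNC F Ntau Nw ->
  semi_montel F (gamma_base F Ntau Nw) /\ semi_reflexive F (gamma_base F Ntau Nw).
Proof.
move=> Hw bbc cnc; have Hg := gamma_base_lcH Ht Hw.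
have H B : bounded F (gamma_base F Ntau Nw) B -> exists C,
    [/\ B `<=` C, absconvex C & is_compact F (gamma_base F Ntau Nw) C].
  move=> bB; have BF := bounded_sub bB.
  have [C [BC cC bC kC]] := bbc _ ((gamma_base_bounded s Ht Hw bbc cnc BF).2 bB).
  by exists C; split=> //; exact: (gamma_base_compact Ht Hw).
split; last exact: (compact_semi_reflexive s Hg).
move=> B /H [C [BC _ kC]]; apply: (closed_compact Hg _ _ kC).
  exact: closure_sub BC (compact_closed Hg kC).
exact: (is_closed_closure Hg).
Qed.

(** Continuity on bounded sets at the origin with tolerance 1 is the defining condition of
    [gamma_base] for the unit ball of the evaluation. *)
Lemma Bdual_nbhd Nw x : lcH F Nw -> Bdual F Ntau Nw (fun f => f x) ->
  nbhd0 (gamma_base F Ntau Nw) [set f | nm (f x) <= 1].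
Proof.
move=> Hw [_ dx]; have HS := lc_subspace Ht.
exists [set f | F f /\ forall i : unit, setT i -> nm (f x) <= 1]; split.
  split; [by move=> f []|by apply: linear_ball_ac => //|].
  move=> B bB; have [W [NW HW]] := dx _ (bounded0U Ht bB) 0 (or_introl erefl) 1 ltr01.
  exists W; split=> // f Bf Wf; split=> [|_ _]; first by case: bB => BF _; exact: BF.
  have := HW f (or_intror Bf); rewrite [f - 0]subr0 => /(_ Wf).
  rewrite -(nm_le1 s); apply: le_trans.
  by rewrite (_ : f x - _ = f x)//; exact: subr0.
by move=> f [_ /(_ tt I)].
Qed.

(** Completeness needs locality on [Ng]-bounded sets, the mixed topology provides it on
    [Ntau]-bounded ones; [BtBg] identifies the two. *)
Lemma gamma_dual_complete Nw Ng : is_gamma F Ntau Nw Ng -> lcH F Nw -> BtBg F Ntau Ng ->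
  complete (dual F Ng) (strong_base F Ng).
Proof.
move=> gam Hw bb; have [Hg _ _] := gam; apply: (strong_dual_complete s Hg).
move=> U US cU loc; apply: (is_gamma_local Ht Hw gam) => // B bB; apply: loc.
by apply/(bb _ (bounded_sub bB)).
Qed.

Lemma semi_reflexive_linearisation Nw Ng : is_gamma F Ntau Nw Ng -> lcH F Nw ->
  CNC F Ntau Nw -> BtBg F Ntau Ng -> (forall x, nbhd0 Ng [set f | nm (f x) <= 1]) ->
  semi_reflexive F Ng -> admits_scb_linearisation F Ntau.
Proof.
move=> gam Hw cnc bb pt sr; have [Hg _ _] := gam; have [_ _ co] := is_gammaP Ht Hw gam.
apply: (predual_linearisation Ht Hborn Hg (CNC_coarser co cnc) bb pt sr).
exact: gamma_dual_complete gam Hw bb.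
Qed.

Lemma weak_gamma_linearisation Nw : lcH F Nw -> BBC F Ntau Nw -> CNC F Ntau Nw ->
  (forall x : Omega, Bdual F Ntau Nw (fun f => f x)) ->
  admits_scb_linearisation F Ntau /\
  exists (W : lmodType K) (S : set W) (N : set (set W)) (phi : V -> ((W -> K^o) -> K^o)),
    [/\ prebidual F Ntau S N phi, semi_montel S N, complete (dual S N) (strong_base S N) &
      (forall x : Omega, exists! y' : W -> K^o,
         dual S N y' /\ forall f, F f -> phi f y' = f x)].
Proof.
move=> Hw bbc cnc dx; have gam := gamma_base_is_gamma Ht Hw.
have Hg := gamma_base_lcH Ht Hw.
have [sm sr] := gamma_semi_montel Hw bbc cnc.
have bb : BtBg F Ntau (gamma_base F Ntau Nw) by move=> B; exact: (gamma_base_bounded s Ht Hw).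
have pt x := Bdual_nbhd Hw (dx x).
split; first exact: semi_reflexive_linearisation gam Hw cnc bb pt sr.
have [_ _ co] := is_gammaP Ht Hw gam.
have [pre un] := predual_prebidual Ht Hborn Hg (CNC_coarser co cnc) bb pt sr.
exists V, F, (gamma_base F Ntau Nw), (evaluation F (gamma_base F Ntau Nw)); split=> //.
exact: gamma_dual_complete gam Hw bb.
Qed.

Lemma linearisation_weak_topology : admits_scb_linearisation F Ntau ->
  exists Nw, [/\ lcH F Nw, coarser (pointwise_base F) Nw, BBC F Ntau Nw & CNC F Ntau Nw].
Proof.
move=> [W [S [N [delta [T [HN HT _ HB]]]]]].
exists (initial_base s F S T); split.
- exact: initial_base_lcH HT.
- exact: pointwise_coarser_initial HT.
- exact: initial_BBC HT HB.
- exact: initial_CNC HT.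
Qed.

Lemma pointwise_Bdual Nw : coarser (pointwise_base F) Nw ->
  forall x : Omega, Bdual F Ntau Nw (fun f => f x).
Proof.
move=> co x; split=> // B bB a Ba e e0.
have [|W [NW HW]] := co [set f : V | F f /\ forall y, List.In y [:: x] -> `|(f y : K)| <= e].
  by exists [:: x], e.
by exists W; split=> // f Bf /HW [_ /(_ x)]; apply; left.
Qed.

End Equivalences.

Theorem theorem4p5 (R : realType) (b : bool) (Omega : Type) (x0 : Omega)
    (F : set (Omega -> (KK R b)^o)) (Ntau : set (set (Omega -> (KK R b)^o)))
    (HF : lcH F Ntau) (Hborn : bornological F Ntau) :
  let K := KK R b in
  let a_ := admits_scb_linearisation F Ntau in
  let b_ := exists (V : lmodType K) (S : set V) (N : set (set V))
              (phi : (Omega -> K^o) -> ((V -> K^o) -> K^o)),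
      [/\ prebidual F Ntau S N phi, semi_montel S N,
          complete (dual S N) (strong_base S N) &
          (forall x : Omega, exists! y' : V -> K^o,
            dual S N y' /\ forall f, F f -> phi f y' = f x)] in
  let c_ := exists Nt : set (set (Omega -> K^o)),
      [/\ lcH F Nt, coarser (pointwise_base F) Nt, BBC F Ntau Nt, CNC F Ntau Nt &
          (exists Ng, is_gamma F Ntau Nt Ng /\ BtBg F Ntau Ng)] in
  let d_ := exists Nt : set (set (Omega -> K^o)),
      [/\ lcH F Nt, coarser (pointwise_base F) Nt, BBCl F Ntau Nt, CNC F Ntau Nt &
          (exists Ng, [/\ is_gamma F Ntau Nt Ng, semi_reflexive F Ng & BtBg F Ntau Ng])] in
  let e_ := exists Nt : set (set (Omega -> K^o)),
      [/\ lcH F Nt, coarser (pointwise_base F) Nt, BBC F Ntau Nt & CNC F Ntau Nt] in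
  let f_ := exists Nt : set (set (Omega -> K^o)),
      [/\ lcH F Nt, BBC F Ntau Nt, CNC F Ntau Nt &
          (forall x : Omega, Bdual F Ntau Nt (fun f => f x))] in
  [/\ a_ <-> b_, a_ <-> c_, a_ <-> d_, a_ <-> e_ & a_ <-> f_].
Proof.
have s := KK_scalars R b; move=> K a_ b_ c_ d_ e_ f_.
have ae : a_ -> e_ by exact: (linearisation_weak_topology s HF).
have ef : e_ -> f_.
  by move=> [Nw [Hw co bbc cnc]]; exists Nw; split=> //; exact: pointwise_Bdual.
have fa : f_ -> a_ /\ b_.
  by move=> [Nw [Hw bbc cnc dx]]; exact: (weak_gamma_linearisation s HF Hborn Hw).
have ba : b_ -> a_.
  by move=> [V [S [N [phi [pre sm cY un]]]]]; exact: (prebidual_linearisation s pre sm cY un).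
have ec : e_ -> c_.
  move=> [Nw [Hw co bbc cnc]]; exists Nw; split=> //.
  exists (gamma_base F Ntau Nw); split; first exact: (gamma_base_is_gamma HF Hw).
  by move=> B; exact: (gamma_base_bounded s HF Hw).
have ed : e_ -> d_.
  move=> [Nw [Hw co bbc cnc]]; exists Nw; split=> //.
    move=> B /bbc [C [BC cC bC kC]]; exists C; split=> //; exact: (compact_closed Hw).
  exists (gamma_base F Ntau Nw); split; first exact: (gamma_base_is_gamma HF Hw).
    by have [] := gamma_semi_montel s HF Hw bbc cnc.
  by move=> B; exact: (gamma_base_bounded s HF Hw).
(* Semi-reflexivity is part of (d), so the predual is built directly on the given [Ng], without
   passing through (e). *)
have da : d_ -> a_.
  move=> [Nw [Hw co _ cnc [Ng [gam sr bb]]]].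
  have [_ _ co'] := is_gammaP HF Hw gam.
  apply: (semi_reflexive_linearisation (s := s) HF Hborn gam Hw cnc bb _ sr) => x.
  exact: coarser_pointwise_nbhd co co'.
have ce : c_ -> e_ by move=> [Nw [Hw co bbc cnc _]]; exists Nw.
split; split=> h.
- by have [] := fa (ef (ae h)).
- exact: ba.
- exact: ec (ae h).
- by have [] := fa (ef (ce h)).
- exact: ed (ae h).
- exact: da.
- exact: ae.
- by have [] := fa (ef h).
- exact: ef (ae h).
- by have [] := fa h.
Qed.
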